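(* Let $n\in\mathbb{N}$, $n\ge 1$, $s>t>0$, $R>0$ and $\eta\in(0,1)$. Let $\varphi$ be the test defined in the context. Whenever $$\rho\geq \left(\frac{1346}{\sqrt{\eta}}+\frac{R}{1-2^{-t}}\right)n^{-\frac{t}{2t+1/2}},$$ the test $\varphi$ fulfils $$\sup_{f\in B_s(R)}\mathbb{P}_f(\varphi=1)+\sup_{f\in \widetilde{B}_{s,t}(R,\rho)}\mathbb{P}_f(\varphi=0)\leq\eta.$$ Hence, $$\rho^\ast(\eta)\leq \left(\frac{1346}{\sqrt{\eta}}+\frac{R}{1-2^{-t}}\right)n^{-\frac{t}{2t+1/2}},$$ i.e. $\rho^\ast(\eta)\lesssim n^{-\frac{t}{2t+1/2}}$, where $\lesssim$ means inequality up to a constant not depending on $n$.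
   Context: Function space and wavelet basis. $L_2=L_2([0,1])$ with scalar product $\langle g,h\rangle=\int_0^1 g(x)h(x)\,\mathrm{d}x$ and norm $\Vert\cdot\Vert_{L_2}$. Fix an orthonormal wavelet basis of $L_2$ of the form $\{\psi_{j,k}: j\ge 2,\ k\in\{1,\dots,2^j\}\}$ (exactly $2^j$ basis functions at resolution $j\ge 2$). For $r>0$ and $g\in L_2$ let $$\Vert g\Vert_{\mathcal{B}_r}=\sqrt{\sum_{j=2}^\infty 4^{jr}\sum_{k=1}^{2^j}\langle g,\psi_{j,k}\rangle^2},\qquad B_r(R)=\{g\in L_2:\Vert g\Vert_{\mathcal{B}_r}\le R\}.$$ For $\rho>0$ let $$\widetilde{B}_{s,t}(R,\rho)=\left\{g\in B_t(R):\ \inf_{h\in B_s(R)}\Vert g-h\Vert_{L_2}>\rho\right\}.$$ Observation. For an unknown fixed $f\in L_2$ one observes $(Y(x))_{x\in[0,1]}$ with $\mathrm{d}Y(x)=f(x)\,\mathrm{d}x+\frac{1}{\sqrt n}\,\mathrm{d}B(x)$, where $B$ is a standard Brownian motion; $\mathbb{P}_f$ is the resulting probability measure. Equivalently, one observes the independent family $\widehat a_{j,k}=\langle \mathrm{d}Y,\psi_{j,k}\rangle\sim\mathcal{N}(a_{j,k},\frac1n)$, $j\ge2$, $1\le k\le 2^j$, where $a_{j,k}=\langle f,\psi_{j,k}\rangle$. A test is a measurable $\{0,1\}$-valued function of the observation. A supremum over the empty set is $0$. Minimax separation distance. $$\rho^\ast(\eta)=\inf\left\{\rho>0:\ \exists\text{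 test }\varphi:\ \sup_{f\in B_s(R)}\mathbb{P}_f(\varphi=1)+\sup_{f\in \widetilde{B}_{s,t}(R,\rho)}\mathbb{P}_f(\varphi=0)\leq\eta\right\}.$$ The test. Write $$\Vert P_j\widehat f\Vert_{L_2}^2=\sum_{k=1}^{2^j}\widehat a_{j,k}^2,\qquad \Vert P_2^{j^\ast}\widehat f\Vert_{\mathcal{B}_s}^2=\sum_{j=2}^{j^\ast}4^{js}\sum_{k=1}^{2^j}\widehat a_{j,k}^2 .$$ Let $J=\left\lfloor \frac{1}{2t+1/2}\frac{\ln(n)}{\ln(2)}\right\rfloor$ and, for $j^\ast\in\{2,3,\dots,J\}$, \begin{align*} A_{j^\ast}&=\frac1n\sum_{j=2}^{j^\ast}(2\cdot 4^s)^j,\\ \alpha_{j^\ast}&=\eta\,\frac{1-2^{-1/5}}{4}\,2^{(j^\ast-J)/5},\\ T_{j^\ast,\alpha_{j^\ast}}&=\Vert P_2^{j^\ast}\widehat{f}\Vert_{\mathcal{B}_s}^2-A_{j^\ast}-\frac{2}{\sqrt{\alpha_{j^\ast}}}\cdot \frac{\sqrt{j^\ast-1}}{\sqrt{n}}\sqrt{\max_{2\leq j\leq j^\ast}\left|16^{js}\left(\Vert P_j\widehat{f}\Vert_{L_2}^2-\frac{2^j}{n}\right)\right|},\\ \beta_{j^\ast}&=\eta\,\frac{1-2^{-1/2}}{2}\,2^{-j^\ast/2},\qquad C_{\beta_{j^\ast}}=\sqrt{\frac{2}{\beta_{j^\ast}}},\\ D_{j^\ast,\beta_{j^\ast}}&=\frac{4^{j^\ast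 s}}{\sqrt{n}}\left(\sqrt{2}\,C_{\beta_{j^\ast}}+2^{j^\ast/4}\sqrt{C_{\beta_{j^\ast}}}\right),\\ \tau_{j^\ast,\alpha_{j^\ast}}&=R^2+\frac{2}{\sqrt{\alpha_{j^\ast}}}\left( \frac{\sqrt{j^\ast-1}}{\sqrt{n}}D_{j^\ast,\beta_{j^\ast}}+4^{j^\ast s}\frac{2^{j^\ast/2}}{n}\right). \end{align*} The test is $$\varphi=1-\prod_{j^{\ast}=2}^{J}\mathbf{1}_{\{T_{j^\ast,\alpha_{j^\ast}}\leq\tau_{j^\ast,\alpha_{j^\ast}}\}}$$ (an empty product equals $1$). *)

(* Defs.v *)
From HB Require Import structures.
From mathcomp Require Import all_boot all_order all_algebra.
From mathcomp Require Import all_classical all_reals all_analysis.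
Import Order.TTheory GRing.Theory Num.Theory.
Import numFieldNormedType.Exports.

Set Implicit Arguments.
Unset Strict Implicit.
Unset Printing Implicit Defensive.

Local Open Scope classical_set_scope.
Local Open Scope ring_scope.

(* Elements of L_2([0,1]) are represented by functions R -> R, of which only
   the values on [0,1] matter. *)
Definition L2 (R : realType) : set (R -> R) :=
  [set g : R -> R | measurable_fun (`[0, 1] : set R) g /\
           (@lebesgue_measure R).-integrable `[0, 1] (fun x => (g x ^+ 2)%:E)].

Definition L2dot (R : realType) (g h : R -> R) : R :=
  (\int[@lebesgue_measure R]_(x in `[0, 1]) (g x * h x))%R.

Definition L2norm (R : realType) (g : R -> R) : R := Num.sqrt (L2dot g g).

(* The index set j >= 2, k in {1, ..., 2^j}; a family indexed by it is encoded
   as a function of two natural numbers whose other values are never used. *)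
Definition windex : set (nat * nat) :=
  [set jk | (2 <= jk.1)%N /\ (1 <= jk.2 <= 2 ^ jk.1)%N].

Definition orthonormal_basis (R : realType) (psi : nat -> nat -> R -> R) : Prop :=
  [/\ forall j k, windex (j, k) -> L2 (psi j k),
      forall j k j' k', windex (j, k) -> windex (j', k') ->
        L2dot (psi j k) (psi j' k') = ((j, k) == (j', k'))%:R
    & (* the linear span is dense in L_2 *)
      forall g eps, L2 g -> 0 < eps ->
        exists (m : nat) (c : nat -> nat -> R),
          L2norm (fun x => g x - \sum_(2 <= j < m) \sum_(1 <= k < (2 ^ j).+1)
                                     c j k * psi j k x) < eps].

Definition besov_norm (R : realType) (psi : nat -> nat -> R -> R) (r : R)
    (g : R -> R) : \bar R :=
  sqrte (\sum_(2 <= j <oo)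
    (4 `^ (j%:R * r) *
      \sum_(1 <= k < (2 ^ j).+1) L2dot g (psi j k) ^+ 2)%:E)%E.

Definition besov_ball (R : realType) (psi : nat -> nat -> R -> R) (r L : R) :
    set (R -> R) :=
  [set g | L2 g /\ (besov_norm psi r g <= L%:E)%E].

Definition besov_alternative (R : realType) (psi : nat -> nat -> R -> R)
    (s t L rho : R) : set (R -> R) :=
  [set g | besov_ball psi t L g /\
     (rho%:E < ereal_inf [set (L2norm (fun x => g x - h x))%:E
                         | h in besov_ball psi s L])%E].

Definition mutually_independent d (T : measurableType d) (R : realType)
    (P : probability T R) (I : choiceType) (D : set I)
    (X : I -> {mfun T >-> R}) : Prop :=
  forall (F : seq I) (B : I -> set R),
    uniq F -> (forall i, i \in F -> D i) -> (forall i, measurable (B i)) ->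
    (P (\bigcap_(i in [set` F]) (X i @^-1` B i)) =
     \prod_(i <- F) P (X i @^-1` B i))%E.

(* The white noise model in sequence form: for every f in L_2, under P f the
   observed coefficients ahat j k are independent with law N(<f,psi_jk>, 1/n).
   The second parameter of [normal_prob] is the standard deviation. *)
Definition white_noise_model (R : realType) (psi : nat -> nat -> R -> R)
    (n : nat) d (T : measurableType d) (P : (R -> R) -> probability T R)
    (ahat : nat -> nat -> {mfun T >-> R}) : Prop :=
  forall f, L2 f ->
    (forall j k, windex (j, k) ->
       forall B : set R, measurable B ->
         distribution (P f) (ahat j k) B =
         normal_prob (L2dot f (psi j k)) (Num.sqrt (n%:R^-1)) B) /\
    mutually_independent (P f) windex (fun jk => ahat jk.1 jk.2).

(* A test is a {0,1}-valued function on the sample space which is measurable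
   with respect to the sigma-algebra generated by the observed coefficients. *)
Definition is_test (R : realType) d (T : measurableType d)
    (ahat : nat -> nat -> {mfun T >-> R}) (phi : T -> bool) : Prop :=
  <<s [set A | exists jk : nat * nat, windex jk /\
         exists2 B : set R, measurable B & A = ahat jk.1 jk.2 @^-1` B] >>
    [set w | phi w = true].

(* Supremum of a set of nonnegative quantities, equal to 0 on the empty set. *)
Definition sup0 (R : realType) (A : set (\bar R)) : \bar R :=
  ereal_sup (0%E |` A).

Definition risk (R : realType) (psi : nat -> nat -> R -> R) (s t L : R)
    d (T : measurableType d) (P : (R -> R) -> probability T R)
    (phi : T -> bool) (rho : R) : \bar R :=
  (sup0 [set P f [set w | phi w = true] | f in besov_ball psi s L] +
   sup0 [set P f [set w | phi w = false] | f in besov_alternative psi s t L rho])%E.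

(* The infimum is taken in the extended reals, so it is +oo if no rho > 0 is
   admissible. *)
Definition separation_distance (R : realType) (psi : nat -> nat -> R -> R)
    (s t L : R) d (T : measurableType d) (P : (R -> R) -> probability T R)
    (ahat : nat -> nat -> {mfun T >-> R}) (eta : R) : \bar R :=
  ereal_inf [set rho%:E | rho in
    [set rho | 0 < rho /\ exists phi : T -> bool,
       is_test ahat phi /\ (risk psi s t L P phi rho <= eta%:E)%E]].

(* Below, y j k stands for the observed coefficient of index (j, k) and m for
   the resolution index j^*. *)

Definition P_sqnorm (R : realType) (y : nat -> nat -> R) (j : nat) : R :=
  \sum_(1 <= k < (2 ^ j).+1) y j k ^+ 2.

Definition P_besov_sqnorm (R : realType) (s : R) (y : nat -> nat -> R) (m : nat) : R :=
  \sum_(2 <= j < m.+1) 4 `^ (j%:R * s) * P_sqnorm y j.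

(* For n >= 1 and t > 0 the argument is nonnegative, so that [Num.truncn] is
   the floor. *)
Definition Jmax (R : realType) (t : R) (n : nat) : nat :=
  Num.truncn (1 / (2 * t + 1 / 2) * (ln n%:R / ln 2)).

Definition A_ (R : realType) (s : R) (n m : nat) : R :=
  1 / n%:R * \sum_(2 <= j < m.+1) (2 * 4 `^ s) ^+ j.

Definition alpha_ (R : realType) (t eta : R) (n m : nat) : R :=
  eta * ((1 - 2 `^ (- (1 / 5))) / 4) * 2 `^ ((m%:R - (Jmax t n)%:R) / 5).

Definition beta_ (R : realType) (eta : R) (m : nat) : R :=
  eta * ((1 - 2 `^ (- (1 / 2))) / 2) * 2 `^ (- (m%:R / 2)).

Definition C_ (R : realType) (eta : R) (m : nat) : R :=
  Num.sqrt (2 / beta_ eta m).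

Definition D_ (R : realType) (s eta : R) (n m : nat) : R :=
  4 `^ (m%:R * s) / Num.sqrt n%:R *
  (Num.sqrt 2 * C_ eta m + 2 `^ (m%:R / 4) * Num.sqrt (C_ eta m)).

Definition tau_ (R : realType) (s t L eta : R) (n m : nat) : R :=
  L ^+ 2 + 2 / Num.sqrt (alpha_ t eta n m) *
    (Num.sqrt (m%:R - 1) / Num.sqrt n%:R * D_ s eta n m +
     4 `^ (m%:R * s) * (2 `^ (m%:R / 2) / n%:R)).

(* The maximum ranges over nonnegative terms, so that 0 is a neutral default. *)
Definition T_ (R : realType) (s t eta : R) (n m : nat) (y : nat -> nat -> R) : R :=
  P_besov_sqnorm s y m - A_ s n m -
  2 / Num.sqrt (alpha_ t eta n m) * (Num.sqrt (m%:R - 1) / Num.sqrt n%:R) *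
    Num.sqrt (\big[Num.max/0]_(2 <= j < m.+1)
      `|16 `^ (j%:R * s) * (P_sqnorm y j - 2 ^+ j / n%:R)|).

(* Boolean rendering of 1 - \prod_m 1_{T_m <= tau_m}. *)
Definition the_test (R : realType) (s t L eta : R) (n : nat)
    (y : nat -> nat -> R) : bool :=
  ~~ \big[andb/true]_(2 <= m < (Jmax t n).+1)
       (T_ s t eta n m y <= tau_ s t L eta n m).

Definition rate (R : realType) (t : R) (n : nat) : R :=
  n%:R `^ (- (t / (2 * t + 1 / 2))).

Definition rate_const (R : realType) (t L eta : R) : R :=
  1346 / Num.sqrt eta + L / (1 - 2 `^ (- t)).

(* Main.v *)
Require Import Defs.
From mathcomp Require Import all_boot all_order all_algebra.
From mathcomp Require Import all_classical all_reals all_analysis.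
From mathcomp Require Import measurable_realfun zify ring lra.
Import Order.TTheory GRing.Theory Num.Theory.
Import numFieldNormedType.Exports.

(** Write [N j] for the energy of the signal at resolution [j] and [S j] for
    that of the observed coefficients.  The statistic compares the observed
    Besov sum with its value under a signal of Besov norm [L].

    Concentration.  A squared Gaussian of mean [a] and variance [1/n], centred,
    has variance [2/n^2 + 4 a^2/n].  Independence makes these centred squares
    orthogonal, so Chebyshev's inequality controls every
    [S j - 2^j/n - N j] outside an event of probability [beta_], and every
    weighted sum of them outside an event of probability [alpha_].  Both
    families of probabilities are geometric and sum to at most [eta/4]
    ([bad_event]).  The variance of the weighted sum contains the unknown
    quantity [M], the largest [4^(j s) * sqrt (N j)]; the level-wise bounds show
    that the empirical maximum inside [T_] estimates [M] up to [D_]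
    ([sqrt_max_deviation]).  Hence, off one event of probability [eta/2],
    [T_] lies between two deterministic bounds ([statistic_bounds]).  The
    upper one is at most [tau_] as soon as the signal is in the null ball,
    which bounds the first error by [eta/2].

    Approximation.  If the test accepts off the same event, the lower bound
    gives, for every [m] up to [J],
    [sum_(j <= m) 4^(j s) N j <= L^2 + c * M + 4^(m s) * delta m].
    Shrinking all amplitudes [sqrt (N j)] by the same threshold [c] absorbs the
    term [c * M], and cutting the resulting Besov sum off at [L^2] then costs
    at most [delta j] at level [j] ([soft_threshold_then_truncate]).  This
    produces an element of the null ball whose squared distance to the signal
    is at most [2 J c^2 + 2 sum_j delta j] plus the energy above resolution
    [J], the latter being at most [L^2 * 4^(-(J+1) t)] because the signal lies
    in the ball of smoothness [t] ([besov_distance_le]).  For the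
    cut-off [J], where [2^J] is about [n^(1/(2 t + 1/2))], both contributions
    are of the order of the squared rate; in the first one the factors [J]
    and [2^((J - j)/10)] are dominated since [c^2] only grows like
    [2^(J/5)] against the available [2^(J/2)] ([budget_total]).  So such a
    signal is closer to the null ball than [rho], and the second error is
    also at most [eta/2]. *)

Set Implicit Arguments.
Unset Strict Implicit.
Unset Printing Implicit Defensive.

Local Open Scope classical_set_scope.
Local Open Scope ring_scope.

(** * Moments of the normal distribution *)

Lemma ge0_integral_normal_prob (R : realType) (m sg : R) (f : R -> \bar R) :
  measurable_fun [set: R] f -> (forall x, 0 <= f x)%E ->
  (\int[normal_prob m sg]_x f x =
   \int[lebesgue_measure]_x (f x * (normal_pdf m sg x)%:E))%E.
Proof.
move=> mf f0.
have dom := @normal_prob_dominates R m sg.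
rewrite -(Radon_Nikodym_SigmaFinite.change_of_variables dom)//.
apply: ae_eq_integral => //.
- apply: emeasurable_funM => //.
  exact: measurable_int (Radon_Nikodym_SigmaFinite.f_integrable _).
- apply: emeasurable_funM => //; apply/measurable_EFinP.
  exact: measurable_normal_pdf.
apply: ae_eqe_mul2l.
apply: integral_ae_eq => //.
- exact: Radon_Nikodym_SigmaFinite.f_integrable.
- by apply/measurable_EFinP; exact: measurable_normal_pdf.
- move=> A _ mA.
  by rewrite -Radon_Nikodym_SigmaFinite.f_integral.
Qed.

Lemma integrable_normal_prob (R : realType) (m sg : R) (f : R -> R) :
  measurable_fun [set: R] f ->
  (@lebesgue_measure R).-integrable [set: R]
     (fun x => (f x * normal_pdf m sg x)%:E) ->
  (normal_prob m sg).-integrable [set: R] (EFin \o f).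
Proof.
move=> mf /integrableP[_ fi]; apply/integrableP; split.
  exact/measurable_EFinP.
rewrite ge0_integral_normal_prob//; last first.
  by apply/measurableT_comp => //; exact/measurable_EFinP.
apply: le_lt_trans fi; apply: ge0_le_integral => //.
- by move=> x _; rewrite mule_ge0// lee_fin normal_pdf_ge0.
- apply: emeasurable_funM; last first.
    by apply/measurable_EFinP; exact: measurable_normal_pdf.
  by apply/measurableT_comp => //; exact/measurable_EFinP.
- apply/measurableT_comp => //; apply/measurable_EFinP.
  by apply: measurable_funM => //; exact: measurable_normal_pdf.
- by move=> x _ /=; rewrite lee_fin normrM (ger0_norm (normal_pdf_ge0 _ _ _)).
Qed.

Lemma integral_normal_prob (R : realType) (m sg : R) (f : R -> R) :
  measurable_fun [set: R] f ->
  (@lebesgue_measure R).-integrable [set: R]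
     (fun x => (f x * normal_pdf m sg x)%:E) ->
  (\int[normal_prob m sg]_x (f x)%:E =
   \int[lebesgue_measure]_x (f x * normal_pdf m sg x)%:E)%E.
Proof.
move=> mf fi; rewrite [LHS]integralE [RHS]integralE.
have mE : measurable_fun setT (EFin \o f) by exact/measurable_EFinP.
rewrite !ge0_integral_normal_prob//; first last.
- exact: measurable_funepos.
- exact: measurable_funeneg.
congr (_ - _)%E; apply: eq_integral => x _.
  by rewrite !funeposE /= -!EFin_max -EFinM maxr_pMl ?normal_pdf_ge0// mul0r.
rewrite !funenegE /= -!EFin_max -EFinM maxr_pMl ?normal_pdf_ge0//.
by rewrite mul0r mulNr.
Qed.

(** Integrate [f] over a growing interval centred at [m] by the fundamental
    theorem of calculus; the boundary terms vanish in the limit because [F]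
    decays at least like [1 / |x - m|]. *)
Lemma integral_derivative_line_eq0 (R : realType) (F f : R -> R) (m K : R) :
  (forall x : R, is_derive x 1 F (f x)) -> continuous f ->
  (@lebesgue_measure R).-integrable [set: R] (EFin \o f) ->
  (forall x, `|(x - m) * F x| <= K) ->
  (\int[lebesgue_measure]_x (f x)%:E = 0)%E.
Proof.
move=> dF cf fi FK.
pose I (n : nat) : set R := `[m - n.+1%:R, m + n.+1%:R]%classic.
have mI n : @measurable _ (measurableTypeR R) (I n) by exact: measurable_itv.
have cF : continuous F.
  by move=> x; apply/differentiable_continuous/derivable1_diffP; exact: (@ex_derive _ _ _ _ _ _ _ (dF x)).
have mf : measurable_fun [set: R] f by exact: continuous_measurable_fun.
have IE n : (\int[lebesgue_measure]_x ((f \_ (I n)) x)%:E =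
   (F (m + n.+1%:R) - F (m - n.+1%:R))%:E)%E.
  transitivity (\int[lebesgue_measure]_x (((EFin \o f) \_ (I n)) x))%E.
    by rewrite restrict_EFin.
  rewrite -integral_mkcond /I /=.
  rewrite (@continuous_FTC2 _ f F)//.
  - by rewrite ltrD2l (@lt_trans _ _ 0)// ?oppr_lt0.
  - exact: continuous_subspaceT.
  - split.
    + by move=> x _; exact: (@ex_derive _ _ _ _ _ _ _ (dF x)).
    + by apply: cvg_at_right_filter; exact: cF.
    + by apply: cvg_at_left_filter; exact: cF.
  - by move=> x _; rewrite derive1E; exact: (@derive_val _ _ _ _ _ _ _ (dF x)).
have FB (x : R) n : `|x - m| = n.+1%:R -> `|F x| <= K / n.+1%:R.
  by move=> xm; rewrite ler_pdivlMr// mulrC -xm -normrM.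
have Ib n : `|F (m + n.+1%:R) - F (m - n.+1%:R)| <= (K *+ 2) * n.+1%:R^-1.
  rewrite mulrnAl mulr2n (le_trans (ler_normB _ _))// lerD//; apply: FB.
    by rewrite addrC addKr ger0_norm.
  by rewrite addrC addKr normrN ger0_norm.
have lim0 : (\int[lebesgue_measure]_x ((f \_ (I n)) x)%:E @[n --> \oo] --> 0)%E.
  under eq_cvg do rewrite IE.
  apply: cvg_EFin; first by near=> n.
  apply/norm_cvg0P.
  apply: (@squeeze_cvgr _ _ _ _ (cst 0) (fun n => (K *+ 2) * n.+1%:R^-1)).
  - by near=> n; rewrite normr_ge0 /= Ib.
  - exact: cvg_cst.
  - rewrite -(mulr0 (K *+ 2)); apply: cvgMl_tmp; exact: cvg_harmonic.
have /cvg_unique : (\int[lebesgue_measure]_x ((f \_ (I n)) x)%:E @[n --> \oo] -->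
    \int[lebesgue_measure]_x (f x)%:E)%E.
  have [|||||_ _ +] := @dominated_convergence _ (measurableTypeR R) R lebesgue_measure setT measurableT
    (fun n x => ((f \_ (I n)) x)%:E) (EFin \o f) (abse \o EFin \o f).
  - move=> n; apply/measurable_EFinP; apply: (measurable_restrictT f (mI n)).1.
    exact: measurable_funTS.
  - exact/measurable_EFinP.
  - apply/aeW => x _.
    apply: cvg_near_cst; near=> n.
    rewrite /= patchE ifT// inE /I /= in_itv /=.
    have : `|x - m| <= n.+1%:R.
      near: n; apply: filterS (nbhs_infty_ger `|x - m|) => n /le_trans; apply.
      by rewrite ler_nat.
    by rewrite ler_norml => /andP[h1 h2]; apply/andP; split; lra.
  - exact: integrable_abse.
  - apply/aeW => x n _ /=; rewrite lee_fin patchE.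
    by case: ifPn => // _; rewrite normr0.
  - exact.
by move=> /(_ (@ereal_hausdorff _) _ lim0).
Unshelve. all: by end_near. Qed.

(** Half of the Gaussian exponent is enough to dominate any power, so a
    polynomial times a normal density is bounded by a multiple of the normal
    density of doubled variance. *)
Lemma normal_moment_bound (R : realType) (m sg : R) (k : nat) : sg != 0 ->
  exists K, 0 <= K /\ forall x,
    `|x - m| ^+ k * normal_pdf m sg x <= K * normal_pdf m (Num.sqrt 2 * sg) x.
Proof.
move=> sg0.
have s20 : Num.sqrt 2 * sg != 0 by rewrite mulf_neq0// sqrtr_eq0 -ltNge.
rewrite !normal_pdfE//.
set c := normal_peak sg; set c' := normal_peak _.
have c0 : 0 < c by exact: normal_peak_gt0.
have c'0 : 0 < c' by exact: normal_peak_gt0.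
(* B bounds |x - m|^k by B * expR u: by 1 when |x - m| <= 1, and otherwise
   through u^(k+1) / (k+1)! <= expR u. *)
pose B := 1 + (4 * sg ^+ 2) ^+ k.+1 * k.+1`!%:R.
have B1 : 1 <= B by rewrite lerDl mulr_ge0// exprn_ge0// mulr_ge0// sqr_ge0.
exists (c / c' * B); split.
  by rewrite !mulr_ge0 ?invr_ge0 ?(ltW c0) ?(ltW c'0)// (le_trans _ B1).
move=> x; rewrite /normal_fun.
pose u := (x - m) ^+ 2 / (4 * sg ^+ 2).
have u0 : 0 <= u by rewrite divr_ge0 ?sqr_ge0// mulr_ge0// sqr_ge0.
have -> : - (x - m) ^+ 2 / (sg ^+ 2 *+ 2) = - u - u.
  by rewrite /u; field.
have -> : - (x - m) ^+ 2 / ((Num.sqrt 2 * sg) ^+ 2 *+ 2) = - u.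
  by rewrite exprMn sqr_sqrtr// /u; field.
suff H : `|x - m| ^+ k * expR (- u) <= B.
  have -> : `|x - m| ^+ k * (c * expR (- u - u)) =
      (c * expR (- u)) * (`|x - m| ^+ k * expR (- u)) by rewrite expRD; ring.
  have -> : c / c' * B * (c' * expR (- u)) = (c * expR (- u)) * B.
    by field; rewrite gt_eqF.
  by rewrite ler_wpM2l// mulr_ge0// ?expR_ge0// ltW.
rewrite expRN ler_pdivrMr ?expR_gt0// mulrC.
have eu := @expR_ge1Dxn _ u k u0.
have e1 : 1 <= expR u by rewrite -expR0 ler_expR.
have [x1|x1] := leP `|x - m| 1.
  apply: (@le_trans _ _ 1); first by rewrite exprn_ile1.
  by rewrite -[1]mulr1 ler_pM.
apply: (@le_trans _ _ ((x - m) ^+ 2 ^+ k.+1)).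
  rewrite -exprM -[leRHS]ger0_norm; last by rewrite exprM exprn_ge0// sqr_ge0.
  by rewrite normrX ler_weXn2l ?(ltW x1)//; lia.
have -> : (x - m) ^+ 2 = (4 * sg ^+ 2) * u.
  by rewrite /u mulrC divfK// mulf_neq0// expf_neq0.
rewrite exprMn.
apply: (@le_trans _ _ (expR u * ((4 * sg ^+ 2) ^+ k.+1 * k.+1`!%:R))); last first.
  by rewrite ler_wpM2l ?expR_ge0// lerDr.
rewrite [leRHS]mulrCA ler_wpM2l//; first by rewrite exprn_ge0// mulr_ge0// sqr_ge0.
rewrite -ler_pdivrMr ?ltr0n ?fact_gt0//; apply: le_trans eu.
by rewrite lerDr.
Qed.

(** Expand the polynomial around [m]. *)
Lemma integrable_poly_normal_pdf (R : realType) (m sg : R) (p : {poly R}) :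
  sg != 0 ->
  (@lebesgue_measure R).-integrable [set: R]
    (fun x => (p.[x] * normal_pdf m sg x)%:E).
Proof.
move=> sg0.
have mono k : (@lebesgue_measure R).-integrable [set: R]
    (fun x => ((x - m) ^+ k * normal_pdf m sg x)%:E).
  have [K [K0 HK]] := normal_moment_bound m k sg0.
  apply: (@le_integrable _ (measurableTypeR R) R lebesgue_measure _ measurableT _
     (fun x => (K * normal_pdf m (Num.sqrt 2 * sg) x)%:E)).
  - apply/measurable_EFinP; apply: measurable_funM; last exact: measurable_normal_pdf.
    by apply: measurable_funX; exact: measurable_funB.
  - move=> x _; rewrite lee_fin !normrM normrX (ger0_norm (normal_pdf_ge0 _ _ _)).
    by rewrite (ger0_norm K0) (ger0_norm (normal_pdf_ge0 _ _ _)).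
  - under eq_fun do rewrite EFinM.
    apply: integrableZl => //; exact: integrable_normal_pdf.
have -> : p = (p \Po ('X + m%:P)) \Po ('X - m%:P).
  by rewrite -comp_polyA comp_polyD comp_polyX comp_polyC subrK comp_polyXr.
set q := p \Po ('X + m%:P).
have -> : (fun x => ((q \Po ('X - m%:P)).[x] * normal_pdf m sg x)%:E) =
  (fun x => \sum_(i < size q) (q`_i)%:E * ((x - m) ^+ i * normal_pdf m sg x)%:E)%E.
  apply/funext => x; rewrite horner_comp !hornerE horner_coef mulr_suml -sumEFin.
  by apply: eq_bigr => i _; rewrite -EFinM mulrA.
by apply: integrable_sum => // i _; exact: integrableZl.
Qed.

(** Stein's identity: the integrand times the density is the derivative of
    [sg^2 * p] times the density.  It computes the moments needed below without
    recursion, by a suitable choice of [p]. *)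
Lemma normal_stein (R : realType) (m sg : R) (p : {poly R}) : sg != 0 ->
  (\int[normal_prob m sg]_x ((sg ^+ 2 *: p^`() - p * ('X - m%:P)).[x])%:E = 0)%E.
Proof.
move=> sg0.
rewrite integral_normal_prob; last 2 first.
- apply: continuous_measurable_fun; apply: continuous_horner.
- exact: (integrable_poly_normal_pdf m _ sg0).
have [K [K0 HK]] : exists K, 0 <= K /\
   forall x, `|(x - m) * (sg ^+ 2 * p.[x] * normal_pdf m sg x)| <= K.
  pose q := (sg ^+ 2 *: p) \Po ('X + m%:P).
  have qE x : sg ^+ 2 * p.[x] = \sum_(i < size q) q`_i * (x - m) ^+ i.
    rewrite -horner_coef /q horner_comp !hornerE; congr (_ * p.[_]); ring.
  have ex (i : 'I_(size q)) : exists K : R, 0 <= K /\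
      forall x, `|x - m| ^+ i.+1 * normal_pdf m sg x <= K.
    have [K [K0 HK]] := normal_moment_bound m i.+1 sg0.
    exists (K * normal_peak (Num.sqrt 2 * sg)); split.
      by rewrite mulr_ge0// normal_peak_ge0.
    move=> x; apply: le_trans (HK x) _; rewrite ler_wpM2l//.
    by rewrite normal_pdf_ub// mulf_neq0// sqrtr_eq0 -ltNge.
  have [KK HKK] := choice ex.
  exists (\sum_(i < size q) `|q`_i| * KK i); split.
    by apply: sumr_ge0 => i _; rewrite mulr_ge0//; case: (HKK i).
  move=> x; rewrite qE mulr_suml mulr_sumr.
  apply: le_trans (ler_norm_sum _ _ _) _; apply: ler_sum => i _.
  have -> : (x - m) * (q`_i * (x - m) ^+ i * normal_pdf m sg x) =
    q`_i * ((x - m) ^+ i.+1 * normal_pdf m sg x) by rewrite exprS; ring.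
  rewrite !normrM (ger0_norm (normal_pdf_ge0 _ _ _)) normrX.
  by rewrite ler_wpM2l//; case: (HKK i).
apply: (@integral_derivative_line_eq0 _
  (fun x => sg ^+ 2 * p.[x] * normal_pdf m sg x) _ m K) => //.
- move=> x; rewrite normal_pdfE// /normal_fun.
  have dp : is_derive x 1 (horner p) p^`().[x].
    apply: DeriveDef; first exact: derivable_horner.
    by rewrite derivE derive1E.
  have dg : is_derive x 1 (fun y : R => - (y - m) ^+ 2 / (sg ^+ 2 *+ 2))
      (- (x - m) / sg ^+ 2).
    apply: is_derive_eq; rewrite /GRing.scale /=; by field.
  have de : is_derive x 1 (fun y : R => expR (- (y - m) ^+ 2 / (sg ^+ 2 *+ 2)))
      (expR (- (x - m) ^+ 2 / (sg ^+ 2 *+ 2)) * (- (x - m) / sg ^+ 2)).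
    have := @is_derive1_comp _ expR _ _ _ _ (is_derive_expR _) dg.
    by [].
  apply: is_derive_eq.
  rewrite hornerD hornerN hornerZ hornerM hornerXsubC /GRing.scale /=.
  by field.
- move=> x; apply: cvgM; first exact: continuous_horner.
  exact: continuous_normal_pdf.
- exact: integrable_poly_normal_pdf.
Qed.

Lemma normal_rv_poly (R : realType) d (T : measurableType d)
    (P : probability T R) (Y : {mfun T >-> R}) (m sg : R) (p : {poly R}) :
  sg != 0 ->
  (forall B : set R, measurable B -> distribution P Y B = normal_prob m sg B) ->
  P.-integrable setT (fun w => (p.[Y w])%:E) /\
  (\int[P]_w (p.[Y w])%:E = \int[normal_prob m sg]_x (p.[x])%:E)%E.
Proof.
move=> sg0 YN.
have mp : measurable_fun [set: R] (EFin \o horner p).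
  apply/measurable_EFinP; apply: continuous_measurable_fun.
  exact: continuous_horner.
have Ni : (normal_prob m sg).-integrable [set: R] (EFin \o horner p).
  apply: integrable_normal_prob; first exact/measurable_EFinP.
  exact: integrable_poly_normal_pdf.
(* The law of Y is that of Y', a measure on the copy of R that carries the
   Lebesgue measure, for which the integral has the same underlying space. *)
have mY : @measurable_fun _ _ T (measurableTypeR R) setT Y.
  by move=> mT B mB; exact: (@measurable_funPT _ _ _ _ Y mT B mB).
pose Y' : {mfun T >-> measurableTypeR R} :=
  MeasurableFun.Pack (MeasurableFun.Class (isMeasurableFun.Build _ _ _ _ _ mY)).
have eqI (f : measurableTypeR R -> \bar R) :
    (\int[distribution P Y']_x f x = \int[normal_prob m sg]_x f x)%E.
  by apply: eq_measure_integral => A mA _; exact: YN.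
have iY : P.-integrable setT (fun w => (p.[Y w])%:E).
  apply/integrableP; split; first exact: (measurableT_comp mp).
  have /integrableP[_ ] := Ni; rewrite -eqI ge0_integral_distribution//.
  exact: measurableT_comp.
by split => //; rewrite -(eqI (fun x => (p.[x])%:E)) integral_distribution.
Qed.

(** Both moments are instances of Stein's identity: [Z] is the Stein
    transform of a polynomial of degree 1, and [Z^2] minus its mean that of a
    polynomial of degree 3. *)
Lemma normal_rv_sqr_centered (R : realType) d (T : measurableType d)
    (P : probability T R) (Y : {mfun T >-> R}) (m sg : R) :
  sg != 0 ->
  (forall B : set R, measurable B -> distribution P Y B = normal_prob m sg B) ->
  let Z := fun w => Y w ^+ 2 - m ^+ 2 - sg ^+ 2 in
  [/\ P.-integrable setT (fun w => (Z w)%:E),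
      (\int[P]_w (Z w)%:E = 0)%E,
      P.-integrable setT (fun w => (Z w ^+ 2)%:E) &
      (\int[P]_w (Z w ^+ 2)%:E = (2 * sg ^+ 4 + 4 * m ^+ 2 * sg ^+ 2)%:E)%E].
Proof.
move=> sg0 YN Z.
(* p1 and p2 are Stein transforms; the coefficients of q cancel those of
   Z^2 - v, written in powers of Y - m, from the top degree down. *)
pose p1 : {poly R} := sg ^+ 2 *: (- ('X + m%:P))^`() - (- ('X + m%:P)) * ('X - m%:P).
have Z1 w : Z w = p1.[Y w].
  rewrite /Z /p1 derivN derivD derivX derivC !hornerE; ring.
pose q : {poly R} := - (('X - m%:P) ^+ 3 + (4 * m) *: ('X - m%:P) ^+ 2
  + (4 * m ^+ 2 + sg ^+ 2) *: ('X - m%:P) + (4 * m * sg ^+ 2)%:P).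
pose v := 2 * sg ^+ 4 + 4 * m ^+ 2 * sg ^+ 2.
pose p2 : {poly R} := sg ^+ 2 *: q^`() - q * ('X - m%:P).
have Z2 w : Z w ^+ 2 = p2.[Y w] + v.
  rewrite /Z /p2 /q derivN !derivD !derivZ !deriv_exp derivB derivX !derivC /v.
  by rewrite !(hornerE, hornerMn, horner_exp) /=; ring.
have [i1 e1] := normal_rv_poly p1 sg0 YN.
have [i2 e2] := normal_rv_poly p2 sg0 YN.
have iv : P.-integrable setT (fun=> v%:E).
  by apply: finite_measure_integrable_cst.
split.
- by under eq_fun do rewrite Z1.
- by under eq_integral do rewrite Z1; rewrite e1 normal_stein.
- by under eq_fun do rewrite Z2 EFinD; apply: integrableD.
- under eq_integral do rewrite Z2 EFinD.
  rewrite integralD_EFin// e2 normal_stein// add0e.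
  by rewrite /= integral_cst//= probability_setT mule1.
Qed.

(** * Chebyshev inequality for independent variables *)

(** The joint law of [X] and [Y] is the product of their laws, since the two
    agree on rectangles; the inner integral given by Fubini's theorem is
    [f x] times the zero mean of [g Y]. *)
Lemma independent_integral_mul_eq0 (R : realType) d (T : measurableType d)
    (P : probability T R) (X Y : {mfun T >-> R}) (f g : R -> R) :
  (forall A B : set R, measurable A -> measurable B ->
     P (X @^-1` A `&` Y @^-1` B) = (P (X @^-1` A) * P (Y @^-1` B))%E) ->
  measurable_fun [set: R] f -> measurable_fun [set: R] g ->
  P.-integrable setT (fun w => (f (X w) * g (Y w))%:E) ->
  P.-integrable setT (fun w => (g (Y w))%:E) ->
  (\int[P]_w (g (Y w))%:E = 0)%E ->
  (\int[P]_w (f (X w) * g (Y w))%:E = 0)%E.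
Proof.
move=> ind mf mg ifg ig g0.
pose XY w := (X w, Y w).
have mXY : measurable_fun [set: T] XY by exact: measurable_fun_pair.
pose XY' : {mfun T >-> (R * R)%type} :=
  MeasurableFun.Pack (MeasurableFun.Class (isMeasurableFun.Build _ _ _ _ _ mXY)).
pose F (z : R * R) := (f z.1 * g z.2)%:E.
have mF : measurable_fun [set: R * R] F.
  by apply/measurable_EFinP; apply: measurable_funM; exact: measurableT_comp.
have prodE A : measurable A -> (distribution P X \x distribution P Y)%E A =
    distribution P XY' A.
  apply: product_measure_unique => B C mB mC.
  by rewrite /= -ind.
have -> : (\int[P]_w (f (X w) * g (Y w))%:E = \int[distribution P XY']_z F z)%E.
  by rewrite integral_distribution.
have iF : (distribution P XY').-integrable [set: R * R] F.
  by apply: integrable_pushforward.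
have eqI (h : R * R -> \bar R) : (\int[distribution P XY']_z h z =
    \int[(distribution P X \x distribution P Y)%E]_z h z)%E.
  by apply: eq_measure_integral => A mA _; exact/esym/prodE.
have iF' : (distribution P X \x distribution P Y)%E.-integrable [set: R * R] F.
  by apply/integrableP; split => //; rewrite -eqI; case/integrableP: iF.
rewrite eqI -integral12_prod_meas1//; apply: integral0_eq => x _.
rewrite /fubini_F /F /=; under eq_integral do rewrite EFinM.
have mEg : measurable_fun [set: R] (EFin \o g) by exact/measurable_EFinP.
rewrite integralZl//; last exact: integrable_pushforward.
rewrite (@integral_distribution _ _ _ _ _ P Y (EFin \o g))//.
by rewrite [X in (_ * X)%E](_ : _ = 0%E) ?mule0.
Qed.

(** The product is at most the sum of the squares. *)
Lemma integrable_mul_sqr (R : realType) d (T : measurableType d)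
    (mu : {measure set T -> \bar R}) (D : set T) (f g : T -> R) :
  measurable D -> measurable_fun D f -> measurable_fun D g ->
  mu.-integrable D (fun w => (f w ^+ 2)%:E) ->
  mu.-integrable D (fun w => (g w ^+ 2)%:E) ->
  mu.-integrable D (fun w => (f w * g w)%:E).
Proof.
move=> mD mf mg f2 g2.
apply: (@le_integrable _ _ _ _ _ mD _ (fun w => ((f w ^+ 2)%:E + (g w ^+ 2)%:E)%E)).
- by apply/measurable_EFinP; exact: measurable_funM.
- move=> w _; rewrite lee_fin normrM [leRHS]ger0_norm ?addr_ge0 ?sqr_ge0//.
  rewrite -(real_normK (num_real (f w))) -(real_normK (num_real (g w))).
  have := sqr_ge0 (`|f w| - `|g w|); have := normr_ge0 (f w); have := normr_ge0 (g w).
  nra.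
- exact: integrableD.
Qed.

(** By orthogonality only the diagonal terms of the squared sum contribute to
    its expectation. *)
Lemma chebyshev_orthogonal (R : realType) d (T : measurableType d)
    (P : probability T R) (I : eqType) (r : seq I) (Z : I -> T -> R)
    (c v : I -> R) (e : R) :
  uniq r -> 0 < e ->
  (forall i, measurable_fun setT (Z i)) ->
  (forall i, P.-integrable setT (fun w => (Z i w ^+ 2)%:E)) ->
  (forall i, \int[P]_w (Z i w ^+ 2)%:E = (v i)%:E)%E ->
  (forall i j, i != j -> \int[P]_w (Z i w * Z j w)%:E = 0)%E ->
  (P [set w | (e <= `|\sum_(i <- r) c i * Z i w|)%R] <=
   ((\sum_(i <- r) c i ^+ 2 * v i) / e ^+ 2)%:E)%E.
Proof.
move=> ur e0 mZ iZ vZ oZ.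
pose S w := \sum_(i <- r) c i * Z i w.
have mS : measurable_fun setT S.
  by apply: measurable_sum => i; apply: measurable_funM.
pose A := [set w | e <= `|S w|].
have mA : measurable A.
  rewrite -[A]setTI; apply: (measurable_fun_le (f := cst e) (g := fun w => `|S w|)) => //.
  exact: measurableT_comp.
rewrite EFinM lee_pdivlMr ?exprn_gt0//.
have -> : ((\sum_(i <- r) c i ^+ 2 * v i)%:E = \int[P]_w (S w ^+ 2)%:E)%E.
  pose f i w := (\sum_(j <- r) (c i * c j)%:E * (Z i w * Z j w)%:E)%E.
  have ij i j : P.-integrable setT (fun w => (c i * c j)%:E * (Z i w * Z j w)%:E)%E.
    by apply: integrableZl => //; exact: integrable_mul_sqr.
  have iF i : P.-integrable setT (f i) by exact: integrable_sum.
  transitivity (\int[P]_w (\sum_(i <- r) f i w))%E; last first.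
    apply: eq_integral => w _; rewrite expr2 /S mulr_suml -sumEFin.
    apply: eq_bigr => i _; rewrite mulr_sumr -sumEFin.
    by apply: eq_bigr => j _; rewrite -EFinM; congr (_%:E); ring.
  rewrite integral_sum// -sumEFin big_seq [RHS]big_seq.
  apply: eq_bigr => i ir; rewrite integral_sum//.
  rewrite (bigD1_seq i)//= integralZl//; last exact: integrable_mul_sqr.
  under eq_integral do rewrite -expr2.
  rewrite vZ -expr2 -EFinM big1 ?adde0// => j ji.
  rewrite integralZl//; last exact: integrable_mul_sqr.
  by rewrite oZ ?mule0// eq_sym.
rewrite (_ : [set w | _] = A `&` setT) ?setIT// muleC -[in P _](setIT A) -integral_indic// -ge0_integralZl//; last 2 first.
- by apply/measurable_EFinP.
- by rewrite lee_fin sqr_ge0.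
apply: ge0_le_integral => //.
- by move=> w _; rewrite -EFinM lee_fin mulr_ge0// sqr_ge0.
- by apply/measurable_EFinP; apply: measurable_funM => //.
- by apply/measurable_EFinP; exact: measurable_funX.
- move=> w _; rewrite -EFinM lee_fin indicE.
  case: (boolP (w \in A)) => [|_]; last by rewrite mulr0 sqr_ge0.
  rewrite inE /A /= mulr1 => eS.
  by rewrite -[leRHS]real_normK ?num_real// lerXn2r// nnegrE ltW.
Qed.

(** * Deviation of the observed energies *)

(** The double sums over resolutions and positions are flattened to sums over
    this list, so that general statements about finite families apply. *)
Definition wavelet_indices (a b : nat) : seq (nat * nat) :=
  [seq (j, k) | j <- index_iota a b, k <- index_iota 1 (2 ^ j).+1].

Lemma mem_wavelet_indices (a b j k : nat) :
  ((j, k) \in wavelet_indices a b) = (a <= j < b)%N && (1 <= k <= 2 ^ j)%N.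
Proof.
apply/allpairsPdep/idP => [[j' [k' [aj kj [-> ->]]]]|/andP[ajb kj]].
  by move: aj kj; rewrite !mem_index_iota ltnS => -> ->.
by exists j; exists k; rewrite !mem_index_iota ltnS.
Qed.

Lemma wavelet_indices_windex (a b : nat) (i : nat * nat) :
  (2 <= a)%N -> i \in wavelet_indices a b -> windex i.
Proof.
case: i => j k a2; rewrite mem_wavelet_indices => /andP[/andP[aj _] kj].
by split => //=; exact: leq_trans aj.
Qed.

Lemma wavelet_indices_uniq (a b : nat) : uniq (wavelet_indices a b).
Proof.
apply: allpairs_uniq_dep => [|j _|[j k] [j' k'] _ _ /=]; try exact: iota_uniq.
by case=> -> ->.
Qed.

Lemma sum_wavelet_indices (R : nmodType) (a b : nat) (F : nat * nat -> R) :
  \sum_(i <- wavelet_indices a b) F i =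
  \sum_(a <= j < b) \sum_(1 <= k < (2 ^ j).+1) F (j, k).
Proof. exact: big_allpairs_dep. Qed.

Definition level_energy (R : realType) (psi : nat -> nat -> R -> R)
    (f : R -> R) (j : nat) : R :=
  \sum_(1 <= k < (2 ^ j).+1) L2dot f (psi j k) ^+ 2.

Lemma mutually_independent_pair d (T : measurableType d) (R : realType)
    (P : probability T R) (I : choiceType) (D : set I)
    (X : I -> {mfun T >-> R}) (i j : I) (A B : set R) :
  mutually_independent P D X -> D i -> D j -> i != j ->
  measurable A -> measurable B ->
  (P (X i @^-1` A `&` X j @^-1` B) = P (X i @^-1` A) * P (X j @^-1` B))%E.
Proof.
move=> ind Di Dj ij mA mB.
have := ind [:: i; j] (fun k => if k == i then A else B).
rewrite !big_cons big_nil mule1 eqxx [j == i]eq_sym (negbTE ij).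
rewrite (_ : \bigcap_(k in _) _ = X i @^-1` A `&` X j @^-1` B); last first.
  apply/seteqP; split=> [w h|w [hA hB] k /=].
    split.
      by have := h i; rewrite /= eqxx; apply; rewrite inE eqxx.
    by have := h j; rewrite /= eq_sym (negbTE ij); apply; rewrite !inE eqxx orbT.
  by rewrite !inE => /orP[/eqP->|/eqP->]; rewrite ?eqxx// eq_sym (negbTE ij).
apply => //=.
- by rewrite inE ij.
- by move=> k; rewrite !inE => /orP[/eqP->|/eqP->].
- by move=> k; case: ifP.
Qed.

(** The centred squares [ahat^2 - a^2 - 1/n] are orthogonal with variance
    [2/n^2 + 4 a^2/n], and there are [2^j] of them at level [j].  Single levels
    and Besov-weighted sums of levels are both of this form. *)
Lemma white_noise_level_deviation (R : realType) (psi : nat -> nat -> R -> R)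
    (n : nat) d (T : measurableType d) (P : (R -> R) -> probability T R)
    (ahat : nat -> nat -> {mfun T >-> R}) (f : R -> R) (a b : nat)
    (c : nat -> R) (e : R) :
  (1 <= n)%N -> white_noise_model psi n P ahat -> L2 f -> (2 <= a)%N -> 0 < e ->
  (P f [set w | (e <= `|\sum_(a <= j < b) c j *
      (P_sqnorm (fun j k => ahat j k w) j - 2 ^+ j / n%:R - level_energy psi f j)|)%R] <=
   ((\sum_(a <= j < b) c j ^+ 2 *
       (2 * 2 ^+ j / n%:R ^+ 2 + 4 * level_energy psi f j / n%:R)) / e ^+ 2)%:E)%E.
Proof.
move=> n1 wn fL2 a2 e0.
have n0 : (n%:R : R) != 0 by rewrite pnatr_eq0 -lt0n.
have [nrm ind] := wn f fL2.
pose sg : R := Num.sqrt n%:R^-1.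
have sg2 : sg ^+ 2 = n%:R^-1 by rewrite sqr_sqrtr// invr_ge0.
have sg0 : sg != 0 by rewrite sqrtr_eq0 -ltNge invr_gt0 lt0r n0 ler0n.
pose coef j k := L2dot f (psi j k).
pose win (i : nat * nat) := (2 <= i.1)%N && (1 <= i.2 <= 2 ^ i.1)%N.
have winP i : win i -> windex i by case/andP.
pose g (i : nat * nat) (x : R) : R :=
  if win i then x ^+ 2 - coef i.1 i.2 ^+ 2 - sg ^+ 2 else 0.
pose Z i w := g i (ahat i.1 i.2 w).
pose v i := if win i then 2 * sg ^+ 4 + 4 * coef i.1 i.2 ^+ 2 * sg ^+ 2 else 0.
have mg i : measurable_fun [set: R] (g i).
  rewrite /g; case: (win i) => //.
  by apply: measurable_funB => //; apply: measurable_funB => //; exact: measurable_funX.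
have mZ i : measurable_fun setT (Z i) by exact: measurableT_comp.
have main i : [/\ (P f).-integrable setT (fun w => (Z i w)%:E),
      (\int[P f]_w (Z i w)%:E = 0)%E,
      (P f).-integrable setT (fun w => (Z i w ^+ 2)%:E) &
      (\int[P f]_w (Z i w ^+ 2)%:E = (v i)%:E)%E].
  rewrite /Z /g /v; case: (boolP (win i)) => [wi|_].
    apply: normal_rv_sqr_centered => // B mB; apply: nrm => //.
    by rewrite -surjective_pairing; exact: winP.
  rewrite expr0n/=; split; rewrite ?integral0//; exact: integrable0.
have orth i j : i != j -> (\int[P f]_w (Z i w * Z j w)%:E = 0)%E.
  move=> ij; have [_ _ i2 _] := main i; have [j1 j0 j2 _] := main j.
  case: (boolP (win i)) => [wi|nwi]; last first.
    by rewrite /Z /g (negbTE nwi); under eq_integral do rewrite mul0r; rewrite integral0.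
  case: (boolP (win j)) => [wj|nwj]; last first.
    by rewrite /Z /g (negbTE nwj); under eq_integral do rewrite mulr0; rewrite integral0.
  apply: independent_integral_mul_eq0 => //.
    move=> A B mA mB.
    by apply: (mutually_independent_pair ind (winP _ wi) (winP _ wj)).
  exact: (integrable_mul_sqr measurableT (mZ i) (mZ j) i2 j2).
pose r := wavelet_indices a b.
have sumE (F : nat * nat -> R) (G : nat -> nat -> R) :
    (forall j k, win (j, k) -> F (j, k) = G j k) ->
    \sum_(i <- r) F i = \sum_(a <= j < b) \sum_(1 <= k < (2 ^ j).+1) G j k.
  move=> FG; rewrite sum_wavelet_indices; apply: eq_big_nat => j /andP[aj jb].
  apply: eq_big_nat => k k2; apply: FG.
  by rewrite /win /= (leq_trans a2 aj) -ltnS.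
have := @chebyshev_orthogonal _ _ _ (P f) _ r Z (fun i => c i.1) v e
  (wavelet_indices_uniq a b) e0 mZ _ _ orth.
move=> /(_ (fun i => let: And4 _ _ h _ := main i in h)).
move=> /(_ (fun i => let: And4 _ _ _ h := main i in h)).
have cstE j (x : R) : \sum_(1 <= k < (2 ^ j).+1) x = 2 ^+ j * x.
  by rewrite sumr_const_nat subn1 /= -natrX mulr_natl.
rewrite (sumE _ (fun j k => c j ^+ 2 * (2 * sg ^+ 4 + 4 * coef j k ^+ 2 * sg ^+ 2))); last first.
  by move=> j k wjk; rewrite /v wjk.
rewrite (_ : \sum_(a <= j < b) _ = \sum_(a <= j < b) c j ^+ 2 *
       (2 * 2 ^+ j / n%:R ^+ 2 + 4 * level_energy psi f j / n%:R)); last first.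
  apply: eq_bigr => j _; rewrite -mulr_sumr big_split /=; congr (_ * (_ + _)).
    rewrite cstE (exprM sg 2 2) sg2.
    by field.
  rewrite /level_energy mulr_sumr mulr_suml; apply: eq_bigr => k _.
  by rewrite sg2.
rewrite (_ : [set w | _] = [set w | (e <= `|\sum_(a <= j < b) c j *
      (P_sqnorm (fun j k => ahat j k w) j - 2 ^+ j / n%:R - level_energy psi f j)|)%R])//.
apply/funext => w /=; congr (is_true (e <= `|_|)).
rewrite (sumE _ (fun j k => c j * (ahat j k w ^+ 2 - coef j k ^+ 2 - sg ^+ 2))); last first.
  by move=> j k wjk; rewrite /Z /g wjk.
apply: eq_bigr => j _; rewrite -mulr_sumr !sumrB; congr (c j * _).
rewrite -/(level_energy psi f j) -/(P_sqnorm (fun j k => ahat j k w) j) sg2.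
by rewrite cstE; ring.
Qed.

(** * Hilbert space structure of square-integrable functions *)

Lemma measurable_itv01 (R : realType) : @measurable _ (measurableTypeR R) `[0, 1].
Proof. exact: measurable_itv. Qed.

Lemma L2_integrable_mul (R : realType) (f g : R -> R) : L2 f -> L2 g ->
  (@lebesgue_measure R).-integrable `[0, 1]%classic (EFin \o (fun x => f x * g x)).
Proof.
move=> [mf f2] [mg g2].
by apply: integrable_mul_sqr => //; exact: measurable_itv.
Qed.

Lemma L2D (R : realType) (f g : R -> R) (c : R) : L2 f -> L2 g ->
  L2 (fun x => f x + c * g x).
Proof.
move=> fL gL; have [mf f2] := fL; have [mg g2] := gL.
have fg := L2_integrable_mul fL gL.
split.
  by apply: measurable_funD => //; exact: measurable_funM.
have mD := @measurable_itv01 R.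
suff : (@lebesgue_measure R).-integrable `[0, 1]%classic (fun x => (f x ^+ 2)%:E +
    ((2 * c)%:E * (f x * g x)%:E + (c ^+ 2)%:E * (g x ^+ 2)%:E))%E.
  apply: eq_integrable => // x _; rewrite -!EFinM -!EFinD; congr (_%:E); ring.
by apply: integrableD => //; apply: integrableD => //; exact: integrableZl.
Qed.

Lemma L2dotC (R : realType) (f g : R -> R) : L2dot f g = L2dot g f.
Proof. by apply: eq_Rintegral => x _; rewrite mulrC. Qed.

Lemma L2dotDl (R : realType) (f g h : R -> R) (c : R) : L2 f -> L2 g -> L2 h ->
  L2dot (fun x => f x + c * g x) h = L2dot f h + c * L2dot g h.
Proof.
move=> fL gL hL; have fh := L2_integrable_mul fL hL.
have gh := L2_integrable_mul gL hL.
have mD := @measurable_itv01 R.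
rewrite /L2dot -RintegralZl// -RintegralD//; last exact: (integrableZl mD c gh).
by apply: eq_Rintegral => x _; ring.
Qed.

Lemma L2_0 (R : realType) : L2 (fun _ : R => 0).
Proof.
split; first exact: measurable_cst.
by rewrite expr0n/=; exact: integrable0.
Qed.

Lemma L2dot0l (R : realType) (h : R -> R) : L2dot (fun=> 0) h = 0.
Proof.
rewrite /L2dot; under eq_Rintegral do rewrite mul0r.
by rewrite Rintegral_cst ?mul0r//; exact: measurable_itv01.
Qed.

Lemma L2dot_ge0 (R : realType) (f : R -> R) : 0 <= L2dot f f.
Proof. by apply: Rintegral_ge0 => x _; rewrite -expr2 sqr_ge0. Qed.

Lemma L2_sum (R : realType) (I : eqType) (r : seq I) (c : I -> R)
    (e : I -> R -> R) : (forall i, i \in r -> L2 (e i)) ->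
  L2 (fun x => \sum_(i <- r) c i * e i x) /\
  forall h, L2 h -> L2dot (fun x => \sum_(i <- r) c i * e i x) h =
    \sum_(i <- r) c i * L2dot (e i) h.
Proof.
elim: r => [_|i r IH er].
  have -> : (fun x : R => \sum_(i <- [::]) c i * e i x) = (fun=> 0).
    by apply/funext => x; rewrite big_nil.
  by split; [exact: L2_0|move=> h _; rewrite L2dot0l big_nil].
have [|L S] := IH; first by move=> j jr; apply: er; rewrite inE jr orbT.
have Li : L2 (e i) by apply: er; rewrite inE eqxx.
have -> : (fun x : R => \sum_(i <- i :: r) c i * e i x) =
    (fun x => \sum_(i <- r) c i * e i x + c i * e i x).
  by apply/funext => x; rewrite big_cons addrC.
split; first exact: L2D.
by move=> h hL; rewrite L2dotDl// S// big_cons addrC.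
Qed.

(** Completing the square: among all combinations of the [e i], the one with
    the coefficients of [f] is the closest to [f]. *)
Lemma L2dot_sub_orthonormal (R : realType) (I : eqType) (r : seq I)
    (c : I -> R) (e : I -> R -> R) (f : R -> R) :
  uniq r -> (forall i, i \in r -> L2 (e i)) ->
  (forall i j, i \in r -> j \in r -> L2dot (e i) (e j) = (i == j)%:R) -> L2 f ->
  let g := fun x => f x - \sum_(i <- r) c i * e i x in
  L2 g /\ L2dot g g =
    L2dot f f - \sum_(i <- r) L2dot f (e i) ^+ 2 +
      \sum_(i <- r) (L2dot f (e i) - c i) ^+ 2.
Proof.
move=> ur eL eo fL g.
pose h x := \sum_(i <- r) c i * e i x.
have [hL hS] := L2_sum c eL.
have gE : g = (fun x => f x + (- 1) * h x) by apply/funext => x; rewrite mulN1r.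
have gL : L2 g by rewrite gE; exact: L2D.
split => //.
have -> : L2dot g g = L2dot f g + (- 1) * L2dot h g by rewrite {1}gE L2dotDl.
have -> : L2dot f g = L2dot f f - \sum_(i <- r) c i * L2dot f (e i).
  rewrite L2dotC gE L2dotDl// hS// mulN1r; congr (_ - _).
  by apply: eq_bigr => i _; rewrite L2dotC.
rewrite hS//.
have -> : \sum_(i <- r) c i * L2dot (e i) g =
    \sum_(i <- r) c i * L2dot f (e i) - \sum_(i <- r) c i ^+ 2.
  rewrite -sumrB; apply: eq_big_seq => i ir.
  rewrite L2dotC gE L2dotDl//; last exact: eL.
  rewrite hS; last exact: eL.
  rewrite (eq_big_seq (fun j => c j * (j == i)%:R)); last first.
    by move=> j jr; rewrite eo.
  rewrite (bigD1_seq i)//= eqxx big1 => [|j /negbTE->]; last by rewrite mulr0.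
  by rewrite /=; ring.
have -> : \sum_(i <- r) (L2dot f (e i) - c i) ^+ 2 = \sum_(i <- r) L2dot f (e i) ^+ 2
   - 2 * \sum_(i <- r) c i * L2dot f (e i) + \sum_(i <- r) c i ^+ 2.
  rewrite mulr_sumr -sumrB -big_split /=; apply: eq_bigr => i _; ring.
ring.
Qed.

(** * Besov balls in wavelet coordinates *)

Lemma level_energy_ge0 (R : realType) (psi : nat -> nat -> R -> R) (f : R -> R)
    (j : nat) : 0 <= level_energy psi f j.
Proof. by apply: sumr_ge0 => k _; exact: sqr_ge0. Qed.

(** The terms of the series are nonnegative, so a bound on the norm amounts to
    a bound on all partial sums. *)
Lemma besov_ballP (R : realType) (psi : nat -> nat -> R -> R) (r L : R)
    (g : R -> R) : 0 <= L ->
  besov_ball psi r L g <-> L2 g /\ forall m,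
    \sum_(2 <= j < m) 4 `^ (j%:R * r) * level_energy psi g j <= L ^+ 2.
Proof.
move=> L0.
have u0 n : (2 <= n)%N -> true ->
    (0 <= (4 `^ (n%:R * r) * level_energy psi g n)%:E)%E.
  by move=> _ _; rewrite lee_fin mulr_ge0 ?powR_ge0// level_energy_ge0.
have -> : besov_ball psi r L g = (L2 g /\ (\sum_(2 <= j <oo)
    (4 `^ (j%:R * r) * level_energy psi g j)%:E <= (L ^+ 2)%:E)%E).
  rewrite /besov_ball /mkset /besov_norm.
  have -> : (L%:E = sqrte (L ^+ 2)%:E)%E by rewrite /= sqrtr_sqr ger0_norm.
  by rewrite lee_sqrt// lee_fin sqr_ge0.
split=> -[gL h]; split => //.
  by move=> m; rewrite -lee_fin -sumEFin; apply: le_trans h; exact: nneseries_lim_ge.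
apply: lime_le; first exact: is_cvg_nneseries.
by apply: nearW => m; rewrite sumEFin lee_fin.
Qed.

(** By density and the best-approximation property of the projections, the
    squared norm of [f] is the sum of all its level energies.  The levels from
    [K] on are controlled by the Besov norm, as [4^(j t) >= 4^(K t)] there. *)
Lemma L2norm_sqr_le_energy (R : realType) (psi : nat -> nat -> R -> R)
    (f : R -> R) (t L : R) (K : nat) :
  orthonormal_basis psi -> 0 < t -> 0 <= L -> besov_ball psi t L f ->
  L2dot f f <= \sum_(2 <= j < K) level_energy psi f j + L ^+ 2 / 4 `^ (K%:R * t).
Proof.
move=> [psiL psio dense] t0 L0 /(besov_ballP _ _ _ L0)[fL fB].
apply/ler_addgt0Pr => e e0.
have se0 : 0 < Num.sqrt e by rewrite sqrtr_gt0.
have [m [c hm]] := dense f _ fL se0.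
have rL i : i \in wavelet_indices 2 m -> L2 (psi i.1 i.2).
  by move/wavelet_indices_windex => /(_ isT); case: i => j k; exact: psiL.
have rO i j : i \in wavelet_indices 2 m -> j \in wavelet_indices 2 m ->
    L2dot (psi i.1 i.2) (psi j.1 j.2) = (i == j)%:R.
  move=> /wavelet_indices_windex => /(_ isT) wi /wavelet_indices_windex => /(_ isT).
  by case: i wi => a b wi; case: j => a' b' wj; rewrite psio.
have [_ ] := L2dot_sub_orthonormal (fun i => c i.1 i.2)
  (wavelet_indices_uniq 2 m) rL rO fL.
set g := fun x => _; move=> gg.
have gE : g = (fun x => f x - \sum_(2 <= j < m) \sum_(1 <= k < (2 ^ j).+1)
                                     c j k * psi j k x).
  by apply/funext => x; rewrite /g sum_wavelet_indices.
rewrite -gE /L2norm in hm.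
have {hm gg} : L2dot f f <= \sum_(2 <= j < m) level_energy psi f j + e.
  have : L2dot g g <= e.
    rewrite -ler_sqrt//; exact: ltW.
  rewrite gg sum_wavelet_indices => le.
  rewrite -lerBlDl; apply: le_trans le; rewrite lerDl.
  by apply: sumr_ge0 => i _; exact: sqr_ge0.
move=> /le_trans; apply; rewrite lerD2r.
pose a := maxn 2 K.
have p1 (j : nat) : (a <= j)%N -> level_energy psi f j <=
    4 `^ (j%:R * t) * level_energy psi f j / 4 `^ (K%:R * t).
  rewrite geq_max => /andP[_ Kj]; rewrite mulrAC ler_peMl ?level_energy_ge0//.
  rewrite ler_pdivlMr ?powR_gt0// mul1r ler_powR ?ler1n// ler_pM2r// ler_nat//.
have aE : \sum_(2 <= j < a) level_energy psi f j = \sum_(2 <= j < K) level_energy psi f j.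
  rewrite /a; case: (leqP 2 K) => // K2.
  by rewrite !big_geq// ltnW.
have am : (a <= m + a)%N by exact: leq_addl.
apply: (@le_trans _ _ (\sum_(2 <= j < m + a) level_energy psi f j)).
  case: (leqP 2 m) => m2; last first.
    by rewrite [leLHS]big_geq ?(ltnW m2)//; apply: sumr_ge0 => *; exact: level_energy_ge0.
  rewrite [leRHS](@big_cat_nat _ _ _ m)//=; last exact: leq_addr.
  by rewrite lerDl; apply: sumr_ge0 => *; exact: level_energy_ge0.
rewrite (@big_cat_nat _ _ _ a)//= ?leq_maxl// aE lerD2l.
apply: (@le_trans _ _ (\sum_(a <= j < m + a)
    4 `^ (j%:R * t) * level_energy psi f j / 4 `^ (K%:R * t))).
  by apply: ler_sum_nat => j /andP[aj _]; exact: p1.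
rewrite -mulr_suml ler_pM2r ?invr_gt0 ?powR_gt0//.
apply: le_trans (fB (m + a)%N).
rewrite [leRHS](@big_cat_nat _ _ _ a)//= ?leq_maxl// lerDr.
by apply: sumr_ge0 => *; rewrite mulr_ge0 ?powR_ge0// level_energy_ge0.
Qed.

Lemma sum_nat_truncate_le (R : numDomainType) (F : nat -> R) (a m K : nat) :
  (forall j, 0 <= F j) ->
  \sum_(a <= j < m) (if (j < K)%N then F j else 0) <= \sum_(a <= j < K) F j.
Proof.
move=> F0; rewrite -big_mkcond /=.
rewrite (@big_nat_widen _ _ _ a m (maxn m K)) ?leq_maxl//=.
rewrite [leRHS](@big_nat_widen _ _ _ a K (maxn m K)) ?leq_maxr//=.
rewrite big_mkcond [leRHS]big_mkcond /=; apply: ler_sum => j _.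
by case: ltnP => //= _; case: ifP.
Qed.

(** Rescale each level of [f] from its amplitude [sqrt (N j)] to [v j]; the
    levels from [K] on are dropped. *)
Lemma besov_distance_le (R : realType) (psi : nat -> nat -> R -> R)
    (f : R -> R) (s t L : R) (K : nat) (v : nat -> R) :
  orthonormal_basis psi -> 0 < t -> 0 <= L -> besov_ball psi t L f ->
  (forall j, 0 <= v j <= Num.sqrt (level_energy psi f j)) ->
  \sum_(2 <= j < K) 4 `^ (j%:R * s) * v j ^+ 2 <= L ^+ 2 ->
  exists2 h, besov_ball psi s L h &
    L2norm (fun x => f x - h x) ^+ 2 <=
      \sum_(2 <= j < K) (Num.sqrt (level_energy psi f j) - v j) ^+ 2 +
      L ^+ 2 / 4 `^ (K%:R * t).
Proof.
move=> onb t0 L0 fB vu vL; have [psiL psio _] := onb.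
have [fL _] := (besov_ballP psi t f L0).1 fB.
have psiLi i : windex i -> L2 (psi i.1 i.2) by case: i => j k; exact: psiL.
have psioi i j : windex i -> windex j ->
    L2dot (psi i.1 i.2) (psi j.1 j.2) = (i == j)%:R.
  by case: i => a b wi; case: j => a' b' wj; rewrite psio.
pose u j := Num.sqrt (level_energy psi f j).
have u2 j : u j ^+ 2 = level_energy psi f j by rewrite sqr_sqrtr// level_energy_ge0.
pose r := wavelet_indices 2 K.
have rw i : i \in r -> windex i by exact: wavelet_indices_windex.
have rL i : i \in r -> L2 (psi i.1 i.2) by move/rw; exact: psiLi.
have rO i j : i \in r -> j \in r ->
    L2dot (psi i.1 i.2) (psi j.1 j.2) = (i == j)%:R.
  by move=> /rw wi /rw wj; exact: psioi.
(* If u vanishes at some level, so does v there, and the quotient is 0. *)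
pose c (i : nat * nat) := v i.1 / u i.1 * L2dot f (psi i.1 i.2).
pose h x := \sum_(i <- r) c i * psi i.1 i.2 x.
have [hL hS] := L2_sum c rL.
have ur : uniq r by exact: wavelet_indices_uniq.
have hc i : windex i -> L2dot h (psi i.1 i.2) = if i \in r then c i else 0.
  move=> wi; rewrite hS; last exact: psiLi.
  rewrite (eq_big_seq (fun k => c k * (k == i)%:R)); last first.
    by move=> k kr; rewrite psioi//; exact: rw.
  case: ifPn => ir.
    rewrite (bigD1_seq i)//= eqxx mulr1 big1 ?addr0// => k /negbTE ->.
    by rewrite mulr0.
  rewrite big_seq big1// => k kr; case: eqP => [kE|_]; last by rewrite mulr0.
  by rewrite -kE kr in ir.
have eh j : (2 <= j)%N -> level_energy psi h j <= if (j < K)%N then v j ^+ 2 else 0.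
  move=> j2; rewrite /level_energy.
  rewrite (eq_big_nat _ _ (F2 := fun k => if (j < K)%N then c (j, k) ^+ 2 else 0)); last first.
    move=> k k12; rewrite (hc (j, k)); last by [].
    by rewrite mem_wavelet_indices j2 /= -ltnS k12 andbT; case: ifP => //; rewrite expr0n.
  case: ifP => jK; last by rewrite big1.
  rewrite /c /=; under eq_bigr do rewrite exprMn.
  rewrite -mulr_sumr -/(level_energy psi f j) -u2 -exprMn.
  have /andP[v0 vuj] := vu j; have [->|uj] := eqVneq (u j) 0.
    by rewrite mulr0 expr0n/= sqr_ge0.
  by rewrite divfK.
exists h.
  apply/(besov_ballP _ _ _ L0); split => // m.
  apply: le_trans vL.
  apply: (@le_trans _ _ (\sum_(2 <= j < m) if (j < K)%N then 4 `^ (j%:R * s) * v j ^+ 2 else 0)).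
    apply: ler_sum_nat => j /andP[j2 _]; have := eh j j2.
    case: ifP => _ e; first by rewrite ler_pM2l ?powR_gt0.
    by rewrite mulr_ge0_le0 ?powR_ge0.
  have p0 j : 0 <= 4 `^ (j%:R * s) * v j ^+ 2 by rewrite mulr_ge0 ?powR_ge0// sqr_ge0.
  exact: sum_nat_truncate_le.
rewrite /L2norm sqr_sqrtr ?L2dot_ge0//.
have [_ ->] := L2dot_sub_orthonormal c ur rL rO fL.
rewrite !sum_wavelet_indices /= -/(level_energy psi f _).
have := L2norm_sqr_le_energy K onb t0 L0 fB; rewrite -lerBlDl => e.
rewrite addrC lerD//.
apply: ler_sum_nat => j _.
rewrite /c /=.
under eq_bigr do rewrite -{1}[L2dot f _]mul1r -mulrBl exprMn.
rewrite -mulr_sumr -/(level_energy psi f j) -u2 -exprMn mulrBl mul1r.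
have /andP[v0 vuj] := vu j; have [->|uj] := eqVneq (u j) 0.
  by rewrite mulr0 subr0 expr0n/= sqr_ge0.
by rewrite divfK// u2 lexx.
Qed.

(** * Approximation by shrinking the levels *)

(** Here [u] plays the role of the amplitudes and [W] of the Besov weights.
    First shrink every [u j] by [c], to [u' j].  At a level [j] that survives
    this, the Besov sum up to [j] has lost at least [c * W l * u l], so it is at
    most [b + W j * delta j].  Then let the Besov sum of [v] be that of [u']
    capped at [b]; the increments lost at level [j] are at most the excess
    over [b] reached there, i.e. [W j * delta j]. *)
Lemma soft_threshold_then_truncate (R : rcfType) (u W delta : nat -> R) (b c : R) (K : nat) :
  (forall j, 0 <= u j) -> (forall j, 0 < W j) ->
  (forall i j, (i <= j)%N -> W i <= W j) -> 0 <= b -> 0 <= c ->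
  (forall j, 0 <= delta j) ->
  (forall m, (2 <= m < K)%N -> exists2 l, (2 <= l <= m)%N &
     \sum_(2 <= j < m.+1) W j * u j ^+ 2 <= b + c * (W l * u l) + W m * delta m) ->
  exists v, [/\ forall j, 0 <= v j <= u j,
    \sum_(2 <= j < K) W j * v j ^+ 2 <= b &
    forall j, (2 <= j < K)%N -> (u j - v j) ^+ 2 <= 2 * c ^+ 2 + 2 * delta j].
Proof.
move=> u0 W0 Wle b0 c0 d0 H.
pose u' j := Num.max (u j - c) 0.
have u'0 j : 0 <= u' j by rewrite le_max lexx orbT.
have u'u j : u' j <= u j by rewrite ge_max u0 andbT lerBlDr lerDl.
have uu' j : u j - u' j <= c by rewrite lerBlDl -lerBlDr le_max lexx.
pose q k := \sum_(2 <= j < k) W j * u' j ^+ 2.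
have qS k : q k <= q k.+1.
  rewrite /q; case: (leqP 2 k) => k2.
    by rewrite big_nat_recr//= lerDl mulr_ge0 ?sqr_ge0// ltW.
  by rewrite big_geq ?(ltnW k2)//; apply: sumr_ge0 => *; rewrite mulr_ge0 ?sqr_ge0// ltW.
have qE j : (2 <= j)%N -> W j * u' j ^+ 2 = q j.+1 - q j.
  by move=> j2; rewrite /q big_nat_recr//= addrAC subrr add0r.
have qle j : (2 <= j < K)%N -> u' j != 0 -> q j.+1 <= b + W j * delta j.
  move=> /[dup] /andP[j2 jK] /H[l /andP[l2 lj] Hj] u'j.
  have cu : c < u j.
    rewrite ltNge; apply: contra u'j => ujc; rewrite /u' max_r// subr_le0//.
  pose gain i := W i * u i ^+ 2 - W i * u' i ^+ 2.
  have gain0 i : 0 <= gain i.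
    by rewrite subr_ge0 ler_wpM2l ?(ltW (W0 i))// lerXn2r// nnegrE.
  have gainE i : c <= u i -> c * (W i * u i) <= gain i.
    move=> cui; rewrite /gain /u' max_l ?subr_ge0//.
    have -> : W i * u i ^+ 2 - W i * (u i - c) ^+ 2 = W i * (c * (u i + (u i - c))).
      ring.
    rewrite mulrCA ler_wpM2l ?(ltW (W0 i))// ler_wpM2l// lerDl subr_ge0//.
  (* Shrinking level l absorbs the linear term if u l >= c; otherwise
     W l * u l <= W j * c, and shrinking level j does. *)
  have [i ij gi] : exists2 i, (2 <= i <= j)%N & c * (W l * u l) <= gain i.
    have [cul|ulc] := leP c (u l).
      by exists l; [rewrite l2|exact: gainE].
    exists j; first by rewrite j2/=.
    apply: le_trans (gainE j (ltW cu)); rewrite ler_wpM2l//.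
    by apply: ler_pM; rewrite ?(ltW (W0 l))// ?Wle// (le_trans (ltW ulc))// ltW.
  have : gain i <= \sum_(2 <= k < j.+1) gain k.
    rewrite (bigD1_seq i)/= ?iota_uniq// ?mem_index_iota// lerDl.
    by apply: sumr_ge0 => k _.
  rewrite sumrB -/(q j.+1) => gs.
  by lra.
pose p k := Num.min (q k) b.
have pq j : 0 <= p j.+1 - p j <= q j.+1 - q j.
  rewrite /p; have := qS j; rewrite !minEle.
  by case: ifP => [|/negbT]; case: ifP => [|/negbT]; rewrite -?ltNge; lra.
(* the amplitudes whose partial Besov sums are the capped ones *)
pose v j := Num.sqrt ((p j.+1 - p j) / W j).
have v2 j : v j ^+ 2 = (p j.+1 - p j) / W j.
  by rewrite sqr_sqrtr// divr_ge0 ?(ltW (W0 j))//; case/andP: (pq j).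
have Wv j : W j * v j ^+ 2 = p j.+1 - p j.
  by rewrite v2 mulrC divfK// gt_eqF.
have vu' j : v j <= u' j.
  case: (leqP 2 j) => j2; last first.
    suff -> : v j = 0 by [].
    by rewrite /v /p /q !big_geq ?(ltnW j2)// subrr mul0r sqrtr0.
  rewrite -(ler_pXn2r (n := 2)) ?nnegrE ?sqrtr_ge0// v2.
  by rewrite ler_pdivrMr// mulrC qE//; case/andP: (pq j).
exists v; split.
- by move=> j; rewrite sqrtr_ge0 (le_trans (vu' j)).
- under eq_bigr do rewrite Wv.
  case: (leqP 2 K) => K2; last by rewrite big_geq// ltnW.
  rewrite telescope_sumr// lerBlDr /p /q [\sum_(2 <= j < 2) _]big_geq//.
  by rewrite (min_l b0) addr0 ge_min lexx orbT.
- move=> j jK; have /andP[j2 _] := jK.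
  have h1 : (u' j - v j) ^+ 2 <= delta j.
    have [u'j|u'j] := eqVneq (u' j) 0.
      have -> : v j = 0.
        by apply/eqP; rewrite eq_le sqrtr_ge0 andbT -u'j.
      by rewrite u'j subrr expr0n.
    apply: (@le_trans _ _ (u' j ^+ 2 - v j ^+ 2)).
      have := vu' j; have : 0 <= v j by exact: sqrtr_ge0.
      by nra.
    rewrite -(ler_pM2l (W0 j)) mulrBr Wv qE//.
    have := qle j jK u'j; have := qS j; have := mulr_ge0 (ltW (W0 j)) (d0 j).
    rewrite /p !minEle.
    by case: ifP => [|/negbT]; case: ifP => [|/negbT]; rewrite -?ltNge; lra.
  have := uu' j; have := u'u j; move: h1.
  set x := u j; set y := u' j; set z := v j => h1 h2 h3.
  have -> : x - z = (x - y) + (y - z) by ring.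
  have : (x - y) ^+ 2 <= c ^+ 2 by rewrite lerXn2r// ?nnegrE ?subr_ge0.
  have := sqr_ge0 ((x - y) - (y - z)).
  by nra.
Qed.

(** Both inequalities come from [x^2 + p x + q^2 <= (x + p + q)^2] and its
    counterpart with the roles of [x] and the root of [S] exchanged.  With
    [x^2] the energy of a level, this turns the deviation of the observed energy
    into one of amplitudes, without any a priori bound on [x]. *)
Lemma sqrt_norm_dev (R : rcfType) (S x p q : R) :
  0 <= x -> 0 <= p -> 0 <= q -> `|S - x ^+ 2| <= p * x + q ^+ 2 ->
  `|Num.sqrt `|S| - x| <= p + q.
Proof.
move=> x0 p0 q0 h.
have b0 : 0 <= Num.sqrt `|S| by exact: sqrtr_ge0.
have b2 : Num.sqrt `|S| ^+ 2 = `|S| by rewrite sqr_sqrtr.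
set b := Num.sqrt `|S| in b0 b2 *.
have h1 : b ^+ 2 <= x ^+ 2 + p * x + q ^+ 2.
  rewrite b2; have -> : S = x ^+ 2 + (S - x ^+ 2) by ring.
  apply: le_trans (ler_normD _ _) _.
  by rewrite (ger0_norm (sqr_ge0 x)) -addrA lerD2l.
have h2 : x ^+ 2 <= b ^+ 2 + p * x + q ^+ 2.
  have -> : x ^+ 2 = `|x ^+ 2| by rewrite ger0_norm// sqr_ge0.
  have -> : x ^+ 2 = S - (S - x ^+ 2) by ring.
  apply: le_trans (ler_normB _ _) _.
  by rewrite b2 -addrA lerD2l.
rewrite ler_norml; apply/andP; split.
- rewrite leNgt; apply/negP => hlt.
  have bx : b * b <= b * x by apply: ler_wpM2l => //; lra.
  have qx : q * q <= q * x by apply: ler_wpM2l => //; lra.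
  have : 0 < x * (x - (b + p + q)) by apply: mulr_gt0; lra.
  by lra.
- rewrite leNgt; apply/negP => hlt.
  have : 0 < (b - (x + p + q)) * (b + (x + p + q)) by apply: mulr_gt0; lra.
  have := mulr_ge0 x0 p0; have := mulr_ge0 x0 q0; have := mulr_ge0 p0 q0.
  by have := sqr_ge0 p; lra.
Qed.

(** * Two-sided bounds on the test statistic *)

Lemma C_ge0 (R : realType) (eta : R) (m : nat) : 0 <= C_ eta m.
Proof. exact: sqrtr_ge0. Qed.

Lemma two_powRN_lt1 (R : realType) (a : R) : 0 < a -> (2 : R) `^ (- a) < 1.
Proof.
move=> a0; rewrite powRN invf_lt1 ?powR_gt0//.
by rewrite -{1}(powRr0 2) /powR gt_eqF// ltr_expR ltr_pM2r// ln_gt0// ltr1n.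
Qed.

Lemma beta_gt0 (R : realType) (eta : R) (m : nat) : 0 < eta -> 0 < beta_ eta m.
Proof.
move=> e0; rewrite /beta_ !mulr_gt0 ?powR_gt0// ?invr_gt0// subr_gt0.
exact: two_powRN_lt1.
Qed.

Lemma alpha_gt0 (R : realType) (t eta : R) (n m : nat) :
  0 < eta -> 0 < alpha_ t eta n m.
Proof.
move=> e0; rewrite /alpha_ !mulr_gt0 ?powR_gt0// ?invr_gt0// subr_gt0.
exact: two_powRN_lt1.
Qed.

Lemma le_C (R : realType) (eta : R) (i j : nat) :
  0 < eta -> (i <= j)%N -> C_ eta i <= C_ eta j.
Proof.
move=> e0 ij; rewrite ler_wsqrtr// ler_wpM2l// lef_pV2 ?posrE ?beta_gt0//.
rewrite /beta_ ler_wpM2l//.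
  rewrite !mulr_ge0 ?invr_ge0// ?(ltW e0)// subr_ge0 ltW//.
  exact: two_powRN_lt1.
by rewrite ler_powR ?ler1n// lerN2 ler_pM2r// ler_nat.
Qed.

Lemma le_D (R : realType) (s eta : R) (n i j : nat) :
  0 <= s -> 0 < eta -> (i <= j)%N -> D_ s eta n i <= D_ s eta n j.
Proof.
move=> s0 e0 ij; have Cij := le_C e0 ij.
rewrite /D_ ler_pM ?divr_ge0 ?powR_ge0 ?sqrtr_ge0 ?addr_ge0 ?mulr_ge0 ?C_ge0//.
  rewrite ?powR_ge0 ?sqrtr_ge0//.
- by rewrite ler_wpM2r ?invr_ge0 ?sqrtr_ge0// ler_powR ?ler1n// ler_wpM2r// ler_nat.
rewrite lerD// ?ler_wpM2l ?sqrtr_ge0//.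
rewrite ler_pM ?powR_ge0 ?sqrtr_ge0//; last by rewrite ler_wsqrtr.
by rewrite ler_powR ?ler1n// ler_pM2r// ler_nat.
Qed.

(** [A_] is the contribution of the noise to the expected Besov sum. *)
Lemma P_besov_sqnorm_centered (R : realType) (s : R) (n m : nat)
    (y : nat -> nat -> R) (N : nat -> R) :
  P_besov_sqnorm s y m - A_ s n m =
  \sum_(2 <= j < m.+1) 4 `^ (j%:R * s) * N j +
  \sum_(2 <= j < m.+1) 4 `^ (j%:R * s) * (P_sqnorm y j - 2 ^+ j / n%:R - N j).
Proof.
rewrite /P_besov_sqnorm /A_ mulr_sumr -sumrB -big_split /=.
apply: eq_bigr => j _.
have -> : (2 * 4 `^ s) ^+ j = 2 ^+ j * (4 : R) `^ (j%:R * s).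
  by rewrite exprMn mulrC [j%:R * s]mulrC powRrM powR_mulrn ?powR_ge0// mulrC.
ring.
Qed.

Lemma le_bigmax_nat (R : realDomainType) (F : nat -> R) (a m j : nat) :
  (a <= j <= m)%N -> F j <= \big[Num.max/0]_(a <= i < m.+1) F i.
Proof.
by move=> jm; apply: le_bigmax_seq => //; rewrite mem_index_iota ltnS.
Qed.

Lemma bigmax_seq_attained (R : realDomainType) (I : eqType) (F : I -> R) (r : seq I) :
  (forall i, 0 <= F i) -> r != [::] ->
  exists2 i, i \in r & \big[Num.max/0]_(i <- r) F i = F i.
Proof.
move=> F0; elim: r => // x [|y r] IH _.
  by exists x; rewrite ?inE// big_cons big_nil max_l.
have [//|l lr e] := IH; rewrite big_cons e.
have [le|le] := leP (F x) (F l); last by exists x; rewrite // inE eqxx.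
by exists l; rewrite // inE lr orbT.
Qed.

(** By [sqrt_norm_dev] each empirical amplitude is within [D_] of the true one
    at its own level; [D_] increases with the level, so the maxima are within
    the [D_] of the last level. *)
Lemma sqrt_max_deviation (R : realType) (s eta : R) (n m : nat)
    (y : nat -> nat -> R) (N : nat -> R) :
  0 <= s -> 0 < eta -> (1 <= n)%N -> (forall j, 0 <= N j) ->
  (forall j, (2 <= j <= m)%N -> `|P_sqnorm y j - 2 ^+ j / n%:R - N j| <=
     C_ eta j * (2 `^ (j%:R / 2) / n%:R + Num.sqrt 2 * Num.sqrt (N j) / Num.sqrt n%:R)) ->
  `|Num.sqrt (\big[Num.max/0]_(2 <= j < m.+1)
      `|16 `^ (j%:R * s) * (P_sqnorm y j - 2 ^+ j / n%:R)|) -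
    \big[Num.max/0]_(2 <= j < m.+1) (4 `^ (j%:R * s) * Num.sqrt (N j))|
  <= D_ s eta n m.
Proof.
move=> s0 e0 n1 N0 G.
have n0 : 0 < n%:R :> R by rewrite ltr0n.
pose z j := P_sqnorm y j - 2 ^+ j / n%:R.
have W16 j : (16 : R) `^ (j%:R * s) = (4 `^ (j%:R * s)) ^+ 2.
  have -> : (16 : R) = 4 * 4 by ring.
  by rewrite powRM// expr2.
have lev j : (2 <= j <= m)%N ->
    `|4 `^ (j%:R * s) * Num.sqrt `|z j| - 4 `^ (j%:R * s) * Num.sqrt (N j)| <= D_ s eta n m.
  move=> jm; have /andP[j2 jm'] := jm.
  apply: le_trans (le_D n s0 e0 jm').
  rewrite -mulrBr normrM ger0_norm ?powR_ge0// /D_ -mulrA ler_wpM2l ?powR_ge0//.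
  pose p := Num.sqrt 2 * C_ eta j / Num.sqrt n%:R.
  pose q := 2 `^ (j%:R / 4) * Num.sqrt (C_ eta j) / Num.sqrt n%:R.
  have -> : (Num.sqrt n%:R)^-1 * (Num.sqrt 2 * C_ eta j +
     2 `^ (j%:R / 4) * Num.sqrt (C_ eta j)) = p + q by rewrite /p /q; ring.
  have q2 : q ^+ 2 = C_ eta j * (2 `^ (j%:R / 2) / n%:R).
    rewrite /q !exprMn exprVn !sqr_sqrtr ?C_ge0//.
    rewrite -[_ `^ (_ / 4) ^+ 2]powR_mulrn ?powR_ge0// -powRrM.
    have -> : (j%:R / 4 * 2%:R : R) = j%:R / 2 by field.
    ring.
  apply: sqrt_norm_dev; rewrite ?sqrtr_ge0// ?divr_ge0 ?mulr_ge0 ?sqrtr_ge0 ?C_ge0 ?powR_ge0//.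
  rewrite sqr_sqrtr// q2; apply: le_trans (G j jm) _.
  by rewrite le_eqVlt; apply/orP; left; apply/eqP; rewrite /p; ring.
have D0 : 0 <= D_ s eta n m.
  by rewrite /D_ mulr_ge0 ?divr_ge0 ?addr_ge0 ?mulr_ge0 ?sqrtr_ge0 ?C_ge0 ?powR_ge0.
set Mh := \big[_/_]_(_ <= _ < _) `|_|; set M := \big[_/_]_(_ <= _ < _) _.
have M0 : 0 <= M by exact: bigmax_ge_id.
have mem j : (j \in index_iota 2 m.+1) = (2 <= j <= m)%N.
  by rewrite mem_index_iota ltnS.
have tj j : Num.sqrt `|16 `^ (j%:R * s) * z j| = 4 `^ (j%:R * s) * Num.sqrt `|z j|.
  rewrite normrM ger0_norm ?powR_ge0// sqrtrM ?powR_ge0// W16 sqrtr_sqr.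
  by rewrite (ger0_norm (powR_ge0 _ _)).
rewrite ler_norml; apply/andP; split.
- rewrite lerBrDr addrC lerBlDr.
  rewrite /M big_seq; apply: bigmax_le; first by rewrite addr_ge0 ?sqrtr_ge0.
  move=> j; rewrite mem => jm.
  have := lev j jm; rewrite ler_norml => /andP[h _].
  have : 4 `^ (j%:R * s) * Num.sqrt `|z j| <= Num.sqrt Mh.
    rewrite -tj ler_wsqrtr//.
    exact: (le_bigmax_nat (fun j => `|16 `^ (j%:R * s) * z j|)).
  by lra.
- rewrite lerBlDr -[leRHS]ger0_norm ?addr_ge0// -sqrtr_sqr ler_wsqrtr//.
  rewrite /Mh big_seq; apply: bigmax_le; first exact: sqr_ge0.
  move=> j; rewrite mem => jm.
  have := lev j jm; rewrite ler_norml => /andP[_ h].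
  have : 4 `^ (j%:R * s) * Num.sqrt (N j) <= M.
    exact: (le_bigmax_nat (fun j => 4 `^ (j%:R * s) * Num.sqrt (N j))).
  move=> hM; rewrite -[leLHS]sqr_sqrtr// tj lerXn2r ?nnegrE ?addr_ge0//.
  by lra.
Qed.

(** The random correction subtracted in [T_] replaces the unknown [M] in the
    deviation bound; it is off by at most [a * kappa * D_]. *)
Lemma statistic_bounds (R : realType) (s t eta : R) (n m : nat)
    (y : nat -> nat -> R) (N : nat -> R) :
  0 <= s -> 0 < eta -> (1 <= n)%N -> (forall j, 0 <= N j) ->
  let a := 2 / Num.sqrt (alpha_ t eta n m) in
  let kappa := Num.sqrt (m%:R - 1) / Num.sqrt n%:R in
  let B := 4 `^ (m%:R * s) * (2 `^ (m%:R / 2) / n%:R) in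
  let M := \big[Num.max/0]_(2 <= j < m.+1) (4 `^ (j%:R * s) * Num.sqrt (N j)) in
  let Q := \sum_(2 <= j < m.+1) 4 `^ (j%:R * s) * N j in
  (forall j, (2 <= j <= m)%N -> `|P_sqnorm y j - 2 ^+ j / n%:R - N j| <=
     C_ eta j * (2 `^ (j%:R / 2) / n%:R + Num.sqrt 2 * Num.sqrt (N j) / Num.sqrt n%:R)) ->
  `|\sum_(2 <= j < m.+1) 4 `^ (j%:R * s) * (P_sqnorm y j - 2 ^+ j / n%:R - N j)| <=
     a * (B + kappa * M) ->
  Q - a * (B + 2 * kappa * M + kappa * D_ s eta n m) <= T_ s t eta n m y <=
  Q + a * (B + kappa * D_ s eta n m).
Proof.
move=> s0 e0 n1 N0 a kappa B M Q G H.
have := sqrt_max_deviation s0 e0 n1 N0 G.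
rewrite /T_ (P_besov_sqnorm_centered s n m y N) -/a -/kappa -/Q -/M.
move: H; set E := \sum_(2 <= j < _) _ * (_ - _); set Mh := Num.sqrt _; set D := D_ _ _ _ _.
rewrite !ler_norml => /andP[h1 h2] /andP[h3 h4].
have a0 : 0 <= a by rewrite divr_ge0 ?sqrtr_ge0.
have k0 : 0 <= kappa by rewrite divr_ge0 ?sqrtr_ge0.
have ak := mulr_ge0 a0 k0.
have h5 := ler_wpM2l ak h3; have h6 := ler_wpM2l ak h4.
by apply/andP; split; lra.
Qed.

(** * Measurability of the test *)

Lemma measurable_sqrtr (R : realType) : measurable_fun [set: R] (@Num.sqrt R).
Proof. by apply: continuous_measurable_fun; exact: sqrt_continuous. Qed.

Lemma measurable_bigmaxr (R : realType) d (T : measurableType d) (I : Type)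
    (r : seq I) (F : I -> T -> R) :
  (forall i, measurable_fun setT (F i)) ->
  measurable_fun setT (fun w => \big[Num.max/0]_(i <- r) F i w).
Proof.
move=> mF; elim: r => [|x r IH].
  by under eq_fun do rewrite big_nil; exact: measurable_cst.
under eq_fun do rewrite big_cons.
exact: measurable_maxr.
Qed.

Lemma measurable_P_sqnorm (R : realType) d (T : measurableType d)
    (y : nat -> nat -> T -> R) (j : nat) :
  (forall j k, measurable_fun setT (y j k)) ->
  measurable_fun setT (fun w => P_sqnorm (fun j k => y j k w) j).
Proof.
by move=> my; apply: measurable_sum => k; exact: measurable_funX.
Qed.

Lemma measurable_T_ (R : realType) d (T : measurableType d)
    (y : nat -> nat -> T -> R) (s t eta : R) (n m : nat) :
  (forall j k, measurable_fun setT (y j k)) ->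
  measurable_fun setT (fun w => T_ s t eta n m (fun j k => y j k w)).
Proof.
move=> my; have mP j := measurable_P_sqnorm j my.
apply: measurable_funB.
  apply: measurable_funB => //.
  by apply: measurable_sum => j; exact: measurable_funM.
apply: measurable_funM => //.
apply: (measurableT_comp (@measurable_sqrtr R)).
apply: measurable_bigmaxr => j; apply: measurableT_comp => //.
by apply: measurable_funM => //; exact: measurable_funB.
Qed.

Lemma the_testP (R : realType) (s t L eta : R) (n : nat) (y : nat -> nat -> R) :
  reflect (exists2 m, (2 <= m <= Jmax t n)%N & tau_ s t L eta n m < T_ s t eta n m y)
    (the_test s t L eta n y).
Proof.
rewrite /the_test big_all -has_predC; apply: (iffP hasP) => -[m].
  by rewrite mem_index_iota ltnS /= -ltNge => mJ h; exists m.
by move=> mJ h; exists m; rewrite ?mem_index_iota ?ltnS//= -ltNge.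
Qed.

Lemma measurable_the_test (R : realType) d (T : measurableType d)
    (y : nat -> nat -> T -> R) (s t L eta : R) (n : nat) :
  (forall j k, measurable_fun setT (y j k)) ->
  measurable [set w | the_test s t L eta n (fun j k => y j k w) = true].
Proof.
move=> my.
pose E m := [set w | tau_ s t L eta n m < T_ s t eta n m (fun j k => y j k w)].
have mE m : measurable (E m).
  rewrite (_ : E m = ~` (setT `&` [set w | T_ s t eta n m (fun j k => y j k w) <=
     (cst (tau_ s t L eta n m) : T -> R) w])).
    by apply: measurableC; apply: measurable_fun_le => //; exact: measurable_T_.
  by rewrite setTI; apply/seteqP; split => w; rewrite /E /= ltNge => /negP.
rewrite (_ : [set w | _] = \bigcup_(m in [set m | (2 <= m <= Jmax t n)%N]) E m).
  exact: bigcup_measurable.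
by apply/seteqP; split => w /=; [move/the_testP|move=> h; apply/the_testP].
Qed.

(** Measurability is only available for the coefficients with an index in
    [windex]; this allows the others to be replaced by constants. *)
Lemma eq_the_test (R : realType) (s t L eta : R) (n : nat) (y z : nat -> nat -> R) :
  (forall j k, windex (j, k) -> y j k = z j k) ->
  the_test s t L eta n y = the_test s t L eta n z.
Proof.
move=> yz.
have P j : (2 <= j)%N -> P_sqnorm y j = P_sqnorm z j.
  by move=> j2; apply: eq_big_nat => k k12; rewrite yz.
rewrite /the_test; congr (~~ _); apply: eq_big_nat => m _; congr (_ <= _).
rewrite /T_ /P_besov_sqnorm; congr (_ - _ - _ * Num.sqrt _).
  by apply: eq_big_nat => j /andP[j2 _]; rewrite P.
by apply: eq_big_nat => j /andP[j2 _]; rewrite P.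
Qed.

Lemma the_test_is_test (R : realType) d (T : measurableType d)
    (ahat : nat -> nat -> {mfun T >-> R}) (s t L eta : R) (n : nat) :
  is_test ahat (fun w => the_test s t L eta n (fun j k => ahat j k w)).
Proof.
rewrite /is_test; set G := [set A | _].
(* outside windex, ahat need not be measurable for the generated
   sigma-algebra *)
pose y j k : g_sigma_algebraType G -> R :=
  if (2 <= j)%N && (1 <= k <= 2 ^ j)%N then ahat j k else cst 0.
have my j k : measurable_fun setT (y j k).
  rewrite /y; case: ifP => [/andP[j2 kj]|_]; last exact: measurable_cst.
  move=> _ B mB; rewrite setTI; apply: sub_sigma_algebra.
  by exists (j, k); split => //; exists B.
have := measurable_the_test s t L eta n my.
congr (_.-sigma.-measurable _); apply/funext => w /=; congr (_ = true).
by apply: eq_the_test => j k [/= j2 kj]; rewrite /y j2 kj.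
Qed.

(** * Probability of a large deviation *)

Lemma bigsetU_probability_le d (T : measurableType d) (R : realType)
    (P : probability T R) (E : nat -> set T) (a b : nat) (p : nat -> R) :
  (forall j, measurable (E j)) -> (forall j, (a <= j < b)%N -> (P (E j) <= (p j)%:E)%E) ->
  (P (\big[setU/set0]_(a <= j < b) E j) <= (\sum_(a <= j < b) p j)%:E)%E.
Proof.
move=> mE; rewrite big_nat_cond [X in X%:E]big_nat_cond.
rewrite /index_iota => pE.
have {pE} : forall j, ((a <= j < b) && true)%N -> (P (E j) <= (p j)%:E)%E.
  by move=> j; rewrite andbT; exact: pE.
elim: (iota _ _) => [|x r IH] pE; first by rewrite !big_nil measure0.
rewrite !big_cons; case: ifPn => // px; last exact: IH.
apply: le_trans (measureU2 _ _ _) _ => //.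
  exact: bigsetU_measurable.
by rewrite EFinD leeD// ?IH// pE.
Qed.

Lemma two_powR_half_sqr (R : realType) (j : nat) :
  ((2 : R) `^ (j%:R / 2)) ^+ 2 = 2 ^+ j.
Proof.
rewrite -powR_mulrn ?powR_ge0// -powRrM divfK// powR_mulrn//.
Qed.

(** The threshold is at least the standard deviation divided by the root of
    [beta_], since a sum of nonnegative numbers squared is at least the sum of
    the squares. *)
Lemma level_deviation_probability (R : realType) (psi : nat -> nat -> R -> R)
    (n : nat) d (T : measurableType d) (P : (R -> R) -> probability T R)
    (ahat : nat -> nat -> {mfun T >-> R}) (f : R -> R) (eta : R) (j : nat) :
  (1 <= n)%N -> white_noise_model psi n P ahat -> L2 f -> 0 < eta -> (2 <= j)%N ->
  (P f [set w | (C_ eta j * (2 `^ (j%:R / 2) / n%:R +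
       Num.sqrt 2 * Num.sqrt (level_energy psi f j) / Num.sqrt n%:R) <=
     `|P_sqnorm (fun j k => ahat j k w) j - 2 ^+ j / n%:R - level_energy psi f j|)%R] <=
   (beta_ eta j)%:E)%E.
Proof.
move=> n1 wn fL e0 j2.
have n0 : 0 < n%:R :> R by rewrite ltr0n.
have b0 := beta_gt0 j e0.
set N := level_energy psi f j; have N0 : 0 <= N by exact: level_energy_ge0.
set e := C_ eta j * _.
have e2 : 2 / beta_ eta j * (2 ^+ j / n%:R ^+ 2 + 2 * N / n%:R) <= e ^+ 2.
  rewrite /e exprMn /C_ sqr_sqrtr ?divr_ge0 ?ler0n ?(ltW b0)//.
  rewrite ler_wpM2l ?divr_ge0 ?ler0n ?(ltW b0)// sqrrD exprMn exprVn two_powR_half_sqr.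
  rewrite [X in _ <= _ + X]exprMn exprVn exprMn !sqr_sqrtr ?(ltW n0)//.
  by rewrite addrAC lerDl mulrn_wge0// mulr_ge0 ?divr_ge0 ?mulr_ge0 ?sqrtr_ge0 ?powR_ge0 ?(ltW n0).
have epos : 0 < e.
  by rewrite mulr_gt0 ?sqrtr_gt0 ?divr_gt0// ltr_pwDl ?divr_gt0 ?powR_gt0.
have := white_noise_level_deviation j.+1 (fun=> 1) n1 wn fL j2 epos.
rewrite big_nat1 expr1n mul1r -/N.
rewrite (_ : [set w | _] = [set w | (e <=
     `|P_sqnorm (fun j k => ahat j k w) j - 2 ^+ j / n%:R - N|)%R]); last first.
  by apply/funext => w /=; rewrite big_nat1 mul1r.
move=> /le_trans; apply; rewrite lee_fin ler_pdivrMr ?exprn_gt0//.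
apply: le_trans (ler_wpM2l (ltW b0) e2).
rewrite mulrA (_ : beta_ eta j * (2 / beta_ eta j) = 2); last first.
  by field; rewrite gt_eqF.
by rewrite le_eqVlt; apply/orP; left; apply/eqP; ring.
Qed.

Lemma sum_geometric_le (R : numDomainType) (x : R) (a b : nat) : 0 <= x -> (a <= b)%N ->
  (1 - x) * \sum_(a <= j < b) x ^+ j <= x ^+ a.
Proof.
move=> x0 ab; rewrite mulr_sumr.
rewrite (eq_bigr (fun j => - x ^+ j.+1 - - x ^+ j)); last first.
  by move=> j _; rewrite exprS; ring.
by rewrite telescope_sumr// opprK addrC lerBlDr lerDl exprn_ge0.
Qed.

Lemma sum_geometric_rev_le (R : numDomainType) (x : R) (a J : nat) : 0 <= x -> (a <= J.+1)%N ->
  (1 - x) * \sum_(a <= j < J.+1) x ^+ (J - j) <= 1.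
Proof.
move=> x0 aJ; rewrite mulr_sumr.
rewrite (eq_big_nat _ _ (F2 := fun j => x ^+ (J.+1 - j.+1) - x ^+ (J.+1 - j))); last first.
  by move=> j /andP[_ jJ]; rewrite subSS subSn// exprS; ring.
by rewrite telescope_sumr// subnn expr0 lerBlDr lerDl exprn_ge0.
Qed.

(** The noise part of the variance is a geometric sum, at most twice its last
    term, and the signal part has [m - 1] terms, each at most [M^2]; these are
    the two summands of the threshold. *)
Lemma statistic_deviation_probability (R : realType) (psi : nat -> nat -> R -> R)
    (n : nat) d (T : measurableType d) (P : (R -> R) -> probability T R)
    (ahat : nat -> nat -> {mfun T >-> R}) (f : R -> R) (s t eta : R) (m : nat) :
  (1 <= n)%N -> white_noise_model psi n P ahat -> L2 f -> 0 <= s -> 0 < eta ->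
  (2 <= m)%N ->
  (P f [set w | (2 / Num.sqrt (alpha_ t eta n m) *
      (4 `^ (m%:R * s) * (2 `^ (m%:R / 2) / n%:R) +
       Num.sqrt (m%:R - 1) / Num.sqrt n%:R *
       \big[Num.max/0]_(2 <= j < m.+1)
          (4 `^ (j%:R * s) * Num.sqrt (level_energy psi f j))) <=
     `|\sum_(2 <= j < m.+1) 4 `^ (j%:R * s) *
        (P_sqnorm (fun j k => ahat j k w) j - 2 ^+ j / n%:R - level_energy psi f j)|)%R] <=
   (alpha_ t eta n m)%:E)%E.
Proof.
move=> n1 wn fL s0 e0 m2.
have n0 : 0 < n%:R :> R by rewrite ltr0n.
have m1 : 0 <= m%:R - 1 :> R by rewrite subr_ge0 ler1n (ltnW m2).
have a0 := alpha_gt0 t n m e0.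
set al := alpha_ t eta n m in a0 *.
set M := \big[_/_]_(_ <= _ < _) _.
set B := 4 `^ (m%:R * s) * _.
set e := 2 / Num.sqrt al * _.
have M0 : 0 <= M by exact: bigmax_ge_id.
have B0 : 0 < B by rewrite mulr_gt0 ?divr_gt0 ?powR_gt0.
have epos : 0 < e.
  rewrite mulr_gt0 ?divr_gt0 ?sqrtr_gt0// ltr_pwDl//.
  by rewrite mulr_ge0 ?divr_ge0 ?sqrtr_ge0.
have e2 : 4 / al * ((4 `^ (m%:R * s)) ^+ 2 * 2 ^+ m / n%:R ^+ 2 + (m%:R - 1) * M ^+ 2 / n%:R) <= e ^+ 2.
  rewrite /e exprMn (_ : (2 / Num.sqrt al) ^+ 2 = 4 / al); last first.
    by rewrite exprMn exprVn sqr_sqrtr ?(ltW a0)//; congr (_ / _); ring.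
  rewrite ler_wpM2l ?divr_ge0 ?(ltW a0)// sqrrD.
  have -> : B ^+ 2 = (4 `^ (m%:R * s)) ^+ 2 * 2 ^+ m / n%:R ^+ 2.
    by rewrite /B !exprMn exprVn two_powR_half_sqr mulrA.
  rewrite !exprMn exprVn !sqr_sqrtr ?(ltW n0)//.
  rewrite addrAC [X in _ <= _ + X + _](_ : _ = (m%:R - 1) * M ^+ 2 / n%:R); last by ring.
  by rewrite lerDl mulrn_wge0// mulr_ge0 ?(ltW B0)// mulr_ge0 ?divr_ge0 ?sqrtr_ge0.
have := white_noise_level_deviation m.+1 (fun j => 4 `^ (j%:R * s)) n1 wn fL (leqnn 2) epos.
move=> /le_trans; apply; rewrite lee_fin ler_pdivrMr ?exprn_gt0//.
apply: le_trans (ler_wpM2l (ltW a0) e2).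
rewrite mulrA (_ : al * (4 / al) = 4); last by field; rewrite gt_eqF.
under eq_bigr do rewrite mulrDr.
rewrite big_split /= mulrDr lerD//.
- apply: (@le_trans _ _ (\sum_(2 <= j < m.+1) (2 * (4 `^ (m%:R * s)) ^+ 2 / n%:R ^+ 2) * 2 ^+ j)).
    apply: ler_sum_nat => j /andP[_ jm].
    rewrite [leLHS](_ : _ = (2 / n%:R ^+ 2 * 2 ^+ j) * (4 `^ (j%:R * s)) ^+ 2); last by ring.
    rewrite [leRHS](_ : _ = (2 / n%:R ^+ 2 * 2 ^+ j) * (4 `^ (m%:R * s)) ^+ 2); last by ring.
    rewrite ler_wpM2l ?mulr_ge0 ?divr_ge0 ?exprn_ge0 ?(ltW n0)//.
    rewrite lerXn2r ?nnegrE ?powR_ge0// ler_powR ?ler1n// ler_wpM2r// ler_nat -ltnS//.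
  rewrite -mulr_sumr.
  have : \sum_(2 <= j < m.+1) (2 : R) ^+ j <= 2 * 2 ^+ m.
    rewrite (eq_bigr (fun j => (2 : R) ^+ j.+1 - 2 ^+ j)); last first.
      by move=> j _; rewrite exprS; ring.
    by rewrite telescope_sumr ?(leq_trans m2)// exprS lerBlDr lerDl exprn_ge0.
  move=> h; apply: le_trans (ler_wpM2l _ h) _.
    by rewrite divr_ge0 ?mulr_ge0 ?sqr_ge0 ?exprn_ge0 ?(ltW n0).
  by rewrite le_eqVlt; apply/orP; left; apply/eqP; ring.
- apply: (@le_trans _ _ (\sum_(2 <= j < m.+1) (4 * M ^+ 2 / n%:R))).
    apply: ler_sum_nat => j /andP[j2 jm].
    set N := level_energy psi f j.
    have -> : (4 `^ (j%:R * s)) ^+ 2 * (4 * N / n%:R) =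
        4 * (4 `^ (j%:R * s) * Num.sqrt N) ^+ 2 / n%:R.
      by rewrite exprMn sqr_sqrtr ?level_energy_ge0//; ring.
    rewrite ler_wpM2r ?invr_ge0 ?(ltW n0)// ler_wpM2l// lerXn2r ?nnegrE//.
    by apply: (le_bigmax_nat (fun j => 4 `^ (j%:R * s) * Num.sqrt (level_energy psi f j)));
      rewrite j2 -ltnS.
  rewrite sumr_const_nat -[_ *+ _]mulr_natr natrB ?(leq_trans m2)//.
  by rewrite le_eqVlt; apply/orP; left; apply/eqP; rewrite -[m.+1]addn1 natrD; ring.
Qed.

Lemma sum_beta_le (R : realType) (eta : R) (J : nat) : 0 < eta ->
  \sum_(2 <= j < J.+1) beta_ eta j <= eta / 4.
Proof.
move=> e0; case: (leqP 2 J.+1) => J2; last first.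
  by rewrite big_geq ?(ltnW J2)// divr_ge0// ltW.
pose x : R := 2 `^ (- (1 / 2)).
have x0 : 0 <= x by exact: powR_ge0.
have x2 : x ^+ 2 = 1 / 2.
  rewrite /x -powR_mulrn ?powR_ge0// -powRrM.
  have -> : - (1 / 2) * 2%:R = - 1 :> R by field.
  by rewrite powR_inv1// mul1r.
rewrite (eq_bigr (fun j => eta / 2 * ((1 - x) * x ^+ j))); last first.
  move=> j _; rewrite /beta_ -/x.
  have -> : (2 : R) `^ (- (j%:R / 2)) = x ^+ j.
    rewrite /x -powR_mulrn ?powR_ge0// -powRrM; congr (_ `^ _); ring.
  ring.
rewrite -!mulr_sumr.
have := sum_geometric_le x0 J2; rewrite x2 => h.
have := ler_wpM2l (_ : 0 <= eta / 2) h; rewrite divr_ge0 ?(ltW e0)// => /(_ isT).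
by move=> /le_trans; apply; rewrite le_eqVlt; apply/orP; left; apply/eqP; field.
Qed.

Lemma sum_alpha_le (R : realType) (t eta : R) (n : nat) : 0 < eta ->
  \sum_(2 <= m < (Jmax t n).+1) alpha_ t eta n m <= eta / 4.
Proof.
move=> e0; set J := Jmax t n; case: (leqP 2 J.+1) => J2; last first.
  by rewrite big_geq ?(ltnW J2)// divr_ge0// ltW.
pose x : R := 2 `^ (- (1 / 5)).
have x0 : 0 <= x by exact: powR_ge0.
rewrite (eq_big_nat _ _ (F2 := fun j => eta / 4 * ((1 - x) * x ^+ (J - j)))); last first.
  move=> j /andP[_ jJ]; rewrite /alpha_ -/x -/J.
  have -> : (2 : R) `^ ((j%:R - J%:R) / 5) = x ^+ (J - j).
    rewrite /x -powR_mulrn ?powR_ge0// -powRrM natrB//; congr (_ `^ _); ring.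
  by move: (x ^+ _) (1 - x) => y z; ring.
rewrite -!mulr_sumr ler_piMr ?divr_ge0 ?(ltW e0)//.
exact: sum_geometric_rev_le.
Qed.

(** [E] is the union of all level-wise and all weighted deviation events. *)
Lemma bad_event (R : realType) (psi : nat -> nat -> R -> R)
    (n : nat) d (T : measurableType d) (P : (R -> R) -> probability T R)
    (ahat : nat -> nat -> {mfun T >-> R}) (f : R -> R) (s t eta : R) :
  (1 <= n)%N -> white_noise_model psi n P ahat -> L2 f -> 0 <= s -> 0 < eta ->
  exists E : set T, [/\ measurable E, (P f E <= (eta / 2)%:E)%E &
    forall w, ~ E w -> forall m, (2 <= m <= Jmax t n)%N ->
      let N := level_energy psi f in
      let M := \big[Num.max/0]_(2 <= j < m.+1) (4 `^ (j%:R * s) * Num.sqrt (N j)) in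
      let Q := \sum_(2 <= j < m.+1) 4 `^ (j%:R * s) * N j in
      let a := 2 / Num.sqrt (alpha_ t eta n m) in
      let kappa := Num.sqrt (m%:R - 1) / Num.sqrt n%:R in
      let B := 4 `^ (m%:R * s) * (2 `^ (m%:R / 2) / n%:R) in
      Q - a * (B + 2 * kappa * M + kappa * D_ s eta n m) <=
        T_ s t eta n m (fun j k => ahat j k w) <=
      Q + a * (B + kappa * D_ s eta n m)].
Proof.
move=> n1 wn fL s0 e0; set J := Jmax t n.
pose N := level_energy psi f.
have N0 j : 0 <= N j by exact: level_energy_ge0.
pose X j w : R := P_sqnorm (fun j k => ahat j k w) j - 2 ^+ j / n%:R - N j.
have mX j : measurable_fun setT (X j).
  by apply: measurable_funB => //; apply: measurable_funB => //; exact: measurable_P_sqnorm.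
pose e j := C_ eta j * (2 `^ (j%:R / 2) / n%:R + Num.sqrt 2 * Num.sqrt (N j) / Num.sqrt n%:R).
pose e' m := 2 / Num.sqrt (alpha_ t eta n m) * (4 `^ (m%:R * s) * (2 `^ (m%:R / 2) / n%:R) +
   Num.sqrt (m%:R - 1) / Num.sqrt n%:R *
       \big[Num.max/0]_(2 <= j < m.+1) (4 `^ (j%:R * s) * Num.sqrt (N j))).
pose G j := [set w | e j <= `|X j w|].
pose H m := [set w | e' m <= `|\sum_(2 <= j < m.+1) 4 `^ (j%:R * s) * X j w|].
have mset (Y : T -> R) (c : R) : measurable_fun setT Y -> measurable [set w | c <= `|Y w|].
  move=> mY; rewrite -[X in measurable X]setTI.
  by apply: (measurable_fun_le (f := cst c)) => //; exact: measurableT_comp.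
have mG j : measurable (G j) by apply: mset.
have mH j : measurable (H j).
  by apply: mset; apply: measurable_sum => i; exact: measurable_funM.
exists (\big[setU/set0]_(2 <= j < J.+1) G j `|` \big[setU/set0]_(2 <= j < J.+1) H j).
have mGG : measurable (\big[setU/set0]_(2 <= j < J.+1) G j) by exact: bigsetU_measurable.
have mHH : measurable (\big[setU/set0]_(2 <= j < J.+1) H j) by exact: bigsetU_measurable.
split.
- exact: measurableU.
- apply: le_trans (measureU2 _ mGG mHH) _.
  have -> : ((eta / 2)%:E = (eta / 4)%:E + (eta / 4)%:E)%E.
    by rewrite -EFinD; congr (_%:E); field.
  apply: leeD.
    apply: (@le_trans _ _ (\sum_(2 <= j < J.+1) beta_ eta j)%:E); last first.
      by rewrite lee_fin sum_beta_le.
    by apply: bigsetU_probability_le => // j /andP[j2 _]; exact: level_deviation_probability.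
  apply: (@le_trans _ _ (\sum_(2 <= j < J.+1) alpha_ t eta n j)%:E); last first.
    by rewrite lee_fin sum_alpha_le.
  by apply: bigsetU_probability_le => // j /andP[j2 _]; exact: statistic_deviation_probability.
- move=> w nE m /andP[m2 mJ].
  have out (F : nat -> set T) j : ~ (\big[setU/set0]_(2 <= j < J.+1) F j) w ->
      (2 <= j <= J)%N -> ~ F j w.
    move=> nF jJ Fj; apply: nF; rewrite -bigcup_seq; exists j => //=.
    by rewrite mem_index_iota ltnS.
  apply: statistic_bounds => //.
    move=> j /andP[j2 jm]; have := out G j (fun h => nE (or_introl h)).
    rewrite j2 (leq_trans jm mJ) => /(_ isT) /negP.
    by rewrite -ltNge => /ltW.
  have := out H m (fun h => nE (or_intror h)).
  by rewrite m2 mJ => /(_ isT) /negP; rewrite -ltNge => /ltW.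
Qed.

(** * The cut-off resolution and the rate *)

Lemma Jmax_le (R : realType) (t : R) (n : nat) : 0 < t -> (1 <= n)%N ->
  (Jmax t n)%:R * ln 2 <= ln (n%:R : R) / (2 * t + 1 / 2) <= (Jmax t n).+1%:R * ln 2.
Proof.
move=> t0 n1; set x := 1 / (2 * t + 1 / 2) * (ln n%:R / ln 2).
have l2 : 0 < ln (2 : R) by rewrite ln_gt0// ltr1n.
have d0 : 0 < 2 * t + 1 / 2 by rewrite addr_gt0// mulr_gt0.
have ln0 : 0 <= ln (n%:R : R) by rewrite ln_ge0// ler1n.
have x0 : 0 <= x by rewrite mulr_ge0 ?divr_ge0 ?(ltW d0) ?(ltW l2).
have xE : ln (n%:R : R) / (2 * t + 1 / 2) = x * ln 2.
  by rewrite /x; field; rewrite (gt_eqF l2)/=; apply/eqP => h; lra.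
rewrite xE /Jmax -/x !ler_pM2r//.
by have /andP[-> /ltW ->] := truncn_itv x0.
Qed.

Lemma rate_sqr (R : realType) (t : R) (n : nat) : (1 <= n)%N ->
  rate t n ^+ 2 = expR (- (2 * t / (2 * t + 1 / 2)) * ln n%:R).
Proof.
move=> n1; rewrite /rate -powR_mulrn ?powR_ge0// -powRrM /powR gt_eqF ?ltr0n//.
rewrite [X in X * _](_ : _ = - (2 * t / (2 * t + 1 / 2)))//.
by move: (2 * t + 1 / 2) => c; ring.
Qed.

Lemma rate_gt0 (R : realType) (t : R) (n : nat) : (1 <= n)%N -> 0 < rate t n.
Proof. by move=> n1; rewrite powR_gt0// ltr0n. Qed.

(** The exponents balance: [1 - 2 t/(2 t + 1/2)] is half of
    [1/(2 t + 1/2)]. *)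
Lemma two_powR_Jmax_le (R : realType) (t : R) (n : nat) : 0 < t -> (1 <= n)%N ->
  2 `^ ((Jmax t n)%:R / 2) / n%:R <= rate t n ^+ 2.
Proof.
move=> t0 n1; have /andP[h _] := Jmax_le t0 n1.
have n0 : 0 < n%:R :> R by rewrite ltr0n.
have d0 : 0 < 2 * t + 1 / 2 by rewrite addr_gt0// mulr_gt0.
rewrite ler_pdivrMr// rate_sqr// -{2}(lnK (x := n%:R))// -expRD /powR gt_eqF//.
rewrite ler_expR.
have -> : - (2 * t / (2 * t + 1 / 2)) * ln n%:R + ln n%:R =
   1 / 2 * (ln n%:R / (2 * t + 1 / 2)).
  by field; apply/eqP => ?; lra.
by lra.
Qed.

Lemma four_powR_Jmax_ge (R : realType) (t : R) (n : nat) : 0 < t -> (1 <= n)%N ->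
  1 / 4 `^ ((Jmax t n).+1%:R * t) <= rate t n ^+ 2.
Proof.
move=> t0 n1; have /andP[_ h] := Jmax_le t0 n1.
have n0 : 0 < n%:R :> R by rewrite ltr0n.
have d0 : 0 < 2 * t + 1 / 2 by rewrite addr_gt0// mulr_gt0.
rewrite rate_sqr// mulNr expRN mul1r lef_pV2 ?posrE ?expR_gt0 ?powR_gt0//.
rewrite /powR gt_eqF// ler_expR.
have -> : ln (4 : R) = 2 * ln 2.
  by rewrite (_ : 4 = 2 * 2 :> R) ?lnM ?posrE//; ring.
have := ler_wpM2l (ltW t0) h.
have -> : 2 * t / (2 * t + 1 / 2) * ln n%:R = 2 * (t * (ln n%:R / (2 * t + 1 / 2))) by ring.
by lra.
Qed.

(** * Size of the thresholds *)

(** All exponents that occur, of the form [m/2], [m/4], [m/5], [m/8] and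
    [m/10], are multiples of 1/40; with an explicit root the estimates become
    inequalities between integer powers. *)
Definition is_root40 (R : realType) (b : R) : Prop :=
  [/\ 1 <= b, b ^+ 40 = 2 &
      forall (k : nat) (x : R), x = k%:R / 40 -> 2 `^ x = b ^+ k].

Lemma root40_exists (R : realType) : exists b : R, is_root40 b.
Proof.
have bE (k : nat) (x : R) : x = k%:R / 40 -> 2 `^ x = (2 `^ (1 / 40)) ^+ k.
  move=> ->; rewrite -[RHS]powR_mulrn ?powR_ge0// -powRrM; congr (_ `^ _).
  by rewrite mul1r mulrC.
exists (2 `^ (1 / 40)); split => //.
- by rewrite -{1}(powRr0 2) ler_powR ?ler1n.
- by rewrite -(@bE 40 1) ?powRr1//; field.
Qed.

(** [(8/7)^5 < 2]. *)
Lemma root40_pow8 (R : realType) (b : R) : is_root40 b -> 8 / 7 <= b ^+ 8.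
Proof.
move=> [b1 b40 _]; rewrite leNgt; apply/negP => lt.
have : (b ^+ 8) ^+ 5 < (8 / 7) ^+ 5.
  by rewrite ltrXn2r ?nnegrE ?exprn_ge0 ?(le_trans _ b1)//; lra.
rewrite -exprM b40; apply/negP; rewrite -leNgt.
by rewrite !exprS expr0; lra.
Qed.

(** [(4/3)^2 < 2]. *)
Lemma root40_pow20 (R : realType) (b : R) : is_root40 b -> 4 / 3 <= b ^+ 20.
Proof.
move=> [b1 b40 _]; rewrite leNgt; apply/negP => lt.
have : (b ^+ 20) ^+ 2 < (4 / 3) ^+ 2.
  by rewrite ltrXn2r ?nnegrE ?exprn_ge0 ?(le_trans _ b1)//; lra.
rewrite -exprM b40; apply/negP; rewrite -leNgt.
by rewrite !exprS expr0; lra.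
Qed.

(** Bernoulli's inequality, with [b^8 >= 9/8]. *)
Lemma nat_le_root40 (R : realType) (b : R) (m : nat) : is_root40 b ->
  m%:R <= 8 * b ^+ (8 * m).
Proof.
move=> br; have b8 := root40_pow8 br.
suff : 1 + m%:R / 8 <= b ^+ (8 * m) by move: (b ^+ _) => z; lra.
elim: m => [|m IH]; first by rewrite muln0 expr0 mul0r addr0.
rewrite mulnS exprD.
apply: (@le_trans _ _ (9 / 8 * (1 + m%:R / 8))).
  by rewrite -natr1; have := ler0n R m; move: (m%:R) => z; lra.
apply: ler_pM => //; apply: le_trans b8; lra.
Qed.

Lemma sqrt_pred_le (R : realType) (b : R) (m : nat) : is_root40 b ->
  Num.sqrt (m%:R - 1) <= 3 * b ^+ (4 * m).
Proof.
move=> br; have [b1 _ _] := br; have b0 : 0 <= b by exact: le_trans b1.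
rewrite -[leRHS]ger0_norm; last by rewrite mulr_ge0// exprn_ge0.
rewrite -sqrtr_sqr ler_wsqrtr// exprMn -exprM mulnAC.
have := nat_le_root40 m br; have : 0 <= b ^+ (8 * m) by rewrite exprn_ge0.
rewrite (_ : 4 * 2 * m = 8 * m)%N//; move: (b ^+ _) (m%:R) => y z.
by rewrite expr2; lra.
Qed.

Lemma inv_sqrt_alpha_le (R : realType) (b t eta : R) (n m : nat) :
  is_root40 b -> 0 < eta -> (m <= Jmax t n)%N ->
  (Num.sqrt (alpha_ t eta n m))^-1 <= 6 * b ^+ (4 * (Jmax t n - m)) / Num.sqrt eta.
Proof.
move=> br e0 mJ; have [b1 _ bE] := br; have b0 : 0 < b by exact: lt_le_trans b1.
have a0 := alpha_gt0 t n m e0.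
rewrite -(ler_pXn2r (n := 2)) ?nnegrE ?invr_ge0 ?sqrtr_ge0 ?divr_ge0 ?mulr_ge0 ?exprn_ge0 ?sqrtr_ge0 ?(ltW b0)//.
rewrite exprVn sqr_sqrtr ?(ltW a0)// !exprMn exprVn sqr_sqrtr ?(ltW e0)//.
move: a0; rewrite /alpha_; move: (Jmax t n) mJ => J mJ a0.
have E8 : (2 : R) `^ (- (1 / 5)) = (b ^+ 8)^-1.
  by rewrite powRN; congr (_^-1); apply: bE; field.
have EJ : (2 : R) `^ ((m%:R - J%:R) / 5) = (b ^+ (8 * (J - m)))^-1.
  rewrite -(opprB J%:R m%:R) mulNr powRN; congr (_^-1).
  by rewrite -natrB//; apply: bE; rewrite natrM; field.
rewrite E8 EJ -exprM mulnAC.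
have y0 : 0 < b ^+ (8 * (J - m)) by rewrite exprn_gt0.
have := root40_pow8 br; have : 0 < b ^+ 8 by rewrite exprn_gt0.
rewrite (_ : 4 * 2 * (J - m) = 8 * (J - m))%N//.
move: (b ^+ (8 * _)) y0 (b ^+ 8) => z z0 y y0 y8 {a0 EJ E8 mJ bE br}.
have iy : y^-1 <= 7 / 8 by rewrite -[leRHS]invrK lef_pV2 ?posrE ?invf_div ?divr_gt0.
move: (y^-1) iy => w w8.
rewrite -[leLHS]mulr1 -[X in _ * X](divff (lt0r_neq0 e0)).
have -> : (eta * ((1 - w) / 4) / z)^-1 * (eta / eta) = (4 / (1 - w)) * (z / eta).
  field; rewrite !gt_eqF//; lra.
rewrite -[leRHS]mulrA ler_wpM2r ?divr_ge0 ?(ltW z0) ?(ltW e0)//.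
rewrite ler_pdivrMr; last lra.
by rewrite expr2; lra.
Qed.

Lemma C_le (R : realType) (b eta : R) (m : nat) : is_root40 b -> 0 < eta ->
  C_ eta m <= 4 * b ^+ (10 * m) / Num.sqrt eta.
Proof.
move=> br e0; have [b1 _ bE] := br; have b0 : 0 < b by exact: lt_le_trans b1.
have be := beta_gt0 m e0.
rewrite -(ler_pXn2r (n := 2)) ?nnegrE ?sqrtr_ge0 ?divr_ge0 ?mulr_ge0 ?exprn_ge0 ?sqrtr_ge0 ?(ltW b0)//.
rewrite sqr_sqrtr ?divr_ge0 ?(ltW be)// !exprMn exprVn sqr_sqrtr ?(ltW e0)//.
rewrite /beta_.
have E20 : (2 : R) `^ (- (1 / 2)) = (b ^+ 20)^-1.
  by rewrite powRN; congr (_^-1); apply: bE; field.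
have Em : (2 : R) `^ (- (m%:R / 2)) = (b ^+ (20 * m))^-1.
  by rewrite powRN; congr (_^-1); apply: bE; rewrite natrM; field.
rewrite E20 Em -exprM mulnAC.
have y0 : 0 < b ^+ (20 * m) by rewrite exprn_gt0.
have := root40_pow20 br; have : 0 < b ^+ 20 by rewrite exprn_gt0.
rewrite (_ : 10 * 2 * m = 20 * m)%N//.
move: (b ^+ (20 * _)) y0 (b ^+ 20) => z z0 y y0 y8 {be Em E20 bE br}.
have iy : y^-1 <= 3 / 4 by rewrite -[leRHS]invrK lef_pV2 ?posrE ?invf_div ?divr_gt0.
move: (y^-1) iy => w w8.
have -> : 2 / (eta * ((1 - w) / 2) / z) = (4 / (1 - w)) * (z / eta).
  field; rewrite !gt_eqF//; lra.
rewrite -[leRHS]mulrA ler_wpM2r ?divr_ge0 ?(ltW z0) ?(ltW e0)//.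
rewrite ler_pdivrMr; last lra.
by rewrite expr2; lra.
Qed.

Lemma inv_sqrt_ge1 (R : realType) (eta : R) : 0 < eta < 1 -> 1 <= (Num.sqrt eta)^-1.
Proof.
move=> /andP[e0 e1]; rewrite invf_ge1 ?sqrtr_gt0//.
by rewrite -[leRHS]sqrtr1 ler_wsqrtr// ltW.
Qed.

(** [eta < 1] allows the fourth root of [eta] to be replaced by its square
    root. *)
Lemma sqrt_C_le (R : realType) (b eta : R) (m : nat) : is_root40 b -> 0 < eta < 1 ->
  Num.sqrt (C_ eta m) <= 2 * b ^+ (5 * m) / Num.sqrt eta.
Proof.
move=> br e01; have /andP[e0 _] := e01.
have [b1 _ _] := br; have b0 : 0 < b by exact: lt_le_trans b1.
have h1 := inv_sqrt_ge1 e01.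
rewrite -[leRHS]ger0_norm; last by rewrite divr_ge0 ?mulr_ge0 ?exprn_ge0 ?sqrtr_ge0 ?(ltW b0).
rewrite -sqrtr_sqr ler_wsqrtr//; apply: le_trans (C_le m br e0) _.
rewrite !exprMn -exprM mulnAC (_ : 5 * 2 * m = 10 * m)%N//.
have y0 : 0 < b ^+ (10 * m) by rewrite exprn_gt0.
move: (b ^+ _) y0 ((Num.sqrt eta)^-1) h1 => y y0 h h1.
have hp : 0 <= h * (h - 1) by rewrite mulr_ge0 ?subr_ge0// (le_trans ler01 h1).
by have := mulr_ge0 (ltW y0) hp; rewrite !expr2; lra.
Qed.

(** A common bound for the factors of [M] in the acceptance inequality, over
    all levels up to [J]. *)
Definition budget_c (R : realType) (b t eta : R) (n : nat) : R :=
  72 * b ^+ (4 * Jmax t n) / Num.sqrt eta / Num.sqrt n%:R.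

(** A bound for the remaining terms of the acceptance inequality at level
    [m], divided by the Besov weight.  It decreases geometrically away from
    [J], so that its sum over the levels carries no factor [J]. *)
Definition budget_delta (R : realType) (b t eta : R) (n m : nat) : R :=
  744 * b ^+ (4 * Jmax t n + 16 * m) / (eta * n%:R).

Lemma budget_c_ge (R : realType) (b t eta : R) (n m : nat) :
  is_root40 b -> 0 < eta -> (m <= Jmax t n)%N ->
  4 / Num.sqrt (alpha_ t eta n m) * (Num.sqrt (m%:R - 1) / Num.sqrt n%:R) <=
  budget_c b t eta n.
Proof.
move=> br e0 mJ.
have A := inv_sqrt_alpha_le br e0 mJ; have S := sqrt_pred_le m br.
rewrite /budget_c [leLHS]mulrA ler_wpM2r ?invr_ge0 ?sqrtr_ge0//.
have := ler_pM _ _ A S; rewrite invr_ge0 !sqrtr_ge0 => /(_ isT isT) H.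
have -> : 72 * b ^+ (4 * Jmax t n) / Num.sqrt eta =
   4 * (6 * b ^+ (4 * (Jmax t n - m)) / Num.sqrt eta * (3 * b ^+ (4 * m))).
  rewrite -[in LHS](subnK mJ) mulnDr exprD.
  by move: (b ^+ _) (b ^+ _) (_^-1) => x y z; ring.
by rewrite -mulrA ler_wpM2l.
Qed.

Lemma sqrt2_le2 (R : rcfType) : Num.sqrt 2 <= 2 :> R.
Proof. by rewrite -[leRHS]ger0_norm// -sqrtr_sqr ler_wsqrtr// expr2; lra. Qed.

(** The two parts of [D_] grow like [b^(10 m)] and [b^(15 m)], hence even with
    the factor [sqrt (m - 1)], of order [b^(4 m)], they stay below [b^(20 m)]. *)
Lemma budget_delta_ge (R : realType) (b s t eta : R) (n m : nat) :
  is_root40 b -> 0 < eta < 1 -> (1 <= n)%N -> (m <= Jmax t n)%N ->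
  4 / Num.sqrt (alpha_ t eta n m) *
    (Num.sqrt (m%:R - 1) / Num.sqrt n%:R * D_ s eta n m +
     4 `^ (m%:R * s) * (2 `^ (m%:R / 2) / n%:R)) <=
  4 `^ (m%:R * s) * budget_delta b t eta n m.
Proof.
move=> br e01 n1 mJ; have /andP[e0 _] := e01.
have a0 : 0 <= (Num.sqrt (alpha_ t eta n m))^-1 by rewrite invr_ge0 sqrtr_ge0.
rewrite /budget_delta; move: a0 (inv_sqrt_alpha_le br e0 mJ).
move: (Num.sqrt (alpha_ t eta n m))^-1 (Jmax t n) mJ => a J mJ a0 A.
have S := sqrt_pred_le m br.
have C1 := C_le m br e0; have C2 := sqrt_C_le m br e01.
have [b1 _ bE] := br; have b0 : 0 < b by exact: lt_le_trans b1.
have h1 := inv_sqrt_ge1 e01.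
have h2 : (Num.sqrt eta)^-1 ^+ 2 = eta^-1 by rewrite exprVn sqr_sqrtr// ltW.
have n0 : 0 < n%:R :> R by rewrite ltr0n.
have sn0 : 0 < Num.sqrt n%:R :> R by rewrite sqrtr_gt0.
have E4 : (2 : R) `^ (m%:R / 4) = b ^+ (10 * m) by apply: bE; rewrite natrM; field.
have E2 : (2 : R) `^ (m%:R / 2) = b ^+ (20 * m) by apply: bE; rewrite natrM; field.
have bb k : 0 <= b ^+ k by rewrite exprn_ge0 ?(ltW b0).
have le_b i j : (i <= j)%N -> b ^+ i <= b ^+ j by move=> ij; rewrite ler_weXn2l.
set W := 4 `^ _; have W0 : 0 <= W by exact: powR_ge0.
rewrite /D_ -/W E4 E2.
have eJ : b ^+ (4 * J + 16 * m) = b ^+ (4 * (J - m)) * b ^+ (20 * m).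
  by rewrite -exprD; congr (b ^+ _); move: mJ; clear; lia.
rewrite eJ {eJ}.
move: A h1 h2 C1 C2; set h := (Num.sqrt eta)^-1 => A h1 h2 C1 C2.
have hh : 0 <= h by exact: le_trans ler01 h1.
move: (b ^+ (4 * (J - m))) (bb (4 * (J - m))%N) A => y y0 A.
set q := Num.sqrt (m%:R - 1) in S *.
have q0 : 0 <= q by exact: sqrtr_ge0.
set c1 := C_ eta m in C1 C2 *.
have c10 : 0 <= c1 by exact: sqrtr_ge0.
set c2 := Num.sqrt c1 in C2 *.
have c20 : 0 <= c2 by exact: sqrtr_ge0.
set i := Num.sqrt 2 * c1 + _.
have i0 : 0 <= i by rewrite addr_ge0 ?mulr_ge0 ?sqrtr_ge0.
have inner : i <= 10 * b ^+ (15 * m) * h.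
  have -> : 10 * b ^+ (15 * m) * h =
      2 * (4 * b ^+ (15 * m) * h) + b ^+ (10 * m) * (2 * b ^+ (5 * m) * h).
    rewrite (_ : 15 * m = 10 * m + 5 * m)%N ?exprD; last by clear; lia.
    by move: (b ^+ _) (b ^+ _) => ? ?; ring.
  apply: lerD; last by rewrite ler_wpM2l.
  apply: ler_pM => //; try exact: sqrtr_ge0; try exact: sqrt2_le2.
  by apply: le_trans C1 _; rewrite ler_wpM2r// ler_wpM2l// le_b//; clear; lia.
have brack : q * i + b ^+ (20 * m) <= 31 * b ^+ (20 * m) * h.
  have -> : 31 * b ^+ (20 * m) * h = 3 * b ^+ (20 * m) * (10 * h) + b ^+ (20 * m) * h.
    by move: (b ^+ _) => ?; ring.
  apply: lerD; last by rewrite ler_peMr.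
  apply: (@le_trans _ _ (3 * b ^+ (4 * m) * (10 * b ^+ (15 * m) * h))); first exact: ler_pM.
  have -> : 3 * b ^+ (4 * m) * (10 * b ^+ (15 * m) * h) =
      3 * (b ^+ (4 * m) * b ^+ (15 * m)) * (10 * h).
    by move: (b ^+ _) (b ^+ _) => ? ?; ring.
  by rewrite ler_wpM2r ?mulr_ge0// ler_wpM2l// -exprD le_b//; clear; lia.
move: (b ^+ (20 * m)) (bb (20 * m)%N) brack => z z0 brack.
have -> : 4 * a * (q / Num.sqrt n%:R * (W / Num.sqrt n%:R * i) + W * (z / n%:R)) =
   W * (4 * (a * (q * i + z)) / n%:R).
  rewrite -[X in z / X](sqr_sqrtr (ltW n0)) -[X in _ = W * (_ / X)](sqr_sqrtr (ltW n0)).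
  move: (Num.sqrt n%:R) sn0 => r r0; field; exact: lt0r_neq0.
rewrite ler_wpM2l//.
have -> : 744 * (y * z) / (eta * n%:R) = 4 * (6 * y * h * (31 * z * h)) / n%:R.
  by rewrite invfM -h2; move: (n%:R^-1) => ni; ring.
rewrite ler_wpM2r ?invr_ge0 ?(ltW n0)// ler_wpM2l//.
by apply: ler_pM => //; rewrite addr_ge0 ?mulr_ge0.
Qed.

Lemma budget_c_ge0 (R : realType) (b t eta : R) (n : nat) :
  0 <= b -> 0 <= budget_c b t eta n.
Proof.
move=> b0; apply: divr_ge0; last exact: sqrtr_ge0.
apply: divr_ge0; last exact: sqrtr_ge0.
by apply: mulr_ge0; [exact: ler0n|exact: exprn_ge0].
Qed.

Lemma budget_delta_ge0 (R : realType) (b t eta : R) (n m : nat) :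
  0 <= b -> 0 <= eta -> 0 <= budget_delta b t eta n m.
Proof.
move=> b0 e0; apply: divr_ge0; last by apply: mulr_ge0; rewrite ?ler0n.
by apply: mulr_ge0; [exact: ler0n|exact: exprn_ge0].
Qed.

Lemma rate_const_gt0 (R : realType) (t L eta : R) :
  0 < t -> 0 < L -> 0 < eta -> 0 < rate_const t L eta.
Proof.
move=> t0 L0 e0; apply: addr_gt0; apply: divr_gt0.
- by rewrite ltr0n.
- by rewrite sqrtr_gt0.
- exact: L0.
- by rewrite subr_gt0 two_powRN_lt1.
Qed.

(** * Undetected signals are close to the null ball *)

Lemma sum_root40_le (R : realType) (b : R) (J : nat) : is_root40 b ->
  \sum_(2 <= j < J.+1) b ^+ (16 * j) <= 8 * b ^+ (16 * J).
Proof.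
move=> br; have b8 := root40_pow8 br; have [b1 _ _] := br.
have b0 : 0 <= b by exact: le_trans b1.
case: (leqP 2 J.+1) => J2; last by rewrite big_geq ?(ltnW J2)// mulr_ge0// exprn_ge0.
apply: (@le_trans _ _ (\sum_(2 <= j < J.+1)
    (8 * b ^+ (16 * j.+1.-1) - 8 * b ^+ (16 * j.-1)))).
  apply: ler_sum_nat => -[//|j] _ /=; rewrite mulnS exprD.
  have b16 : 8 / 7 <= b ^+ 16 by apply: le_trans b8 _; rewrite ler_weXn2l.
  have := exprn_ge0 (16 * j) b0; move: (b ^+ (16 * j)) (b ^+ 16) b16 => x y y8 x0.
  have : 0 <= x * (y - 8 / 7) by rewrite mulr_ge0// subr_ge0.
  by lra.
by rewrite telescope_sumr//= lerBlDr lerDl mulr_ge0// exprn_ge0.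
Qed.

(** The threshold contributes [J * b^(8 J)], which is at most
    [8 * b^(16 J)], and the geometric sum of the remainders [b^(20 J)]; the
    latter power is [2^(J/2)]. *)
Lemma budget_total (R : realType) (b t eta : R) (n : nat) :
  is_root40 b -> 0 < t -> 0 < eta -> (1 <= n)%N ->
  \sum_(2 <= j < (Jmax t n).+1) (2 * budget_c b t eta n ^+ 2 + 2 * budget_delta b t eta n j)
    <= (1346 / Num.sqrt eta) ^+ 2 * rate t n ^+ 2.
Proof.
move=> br t0 e0 n1; have [b1 _ bE] := br; have b0 : 0 <= b by exact: le_trans b1.
have bb k : 0 <= b ^+ k by rewrite exprn_ge0.
have n0 : 0 < n%:R :> R by rewrite ltr0n.
have eE0 : 0 <= eta^-1 / n%:R by rewrite divr_ge0 ?invr_ge0 ?(ltW e0).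
apply: le_trans (ler_wpM2l (sqr_ge0 _) (two_powR_Jmax_le t0 n1)).
rewrite /budget_c /budget_delta; move: (Jmax t n) => J.
have -> : (2 : R) `^ (J%:R / 2) = b ^+ (20 * J) by apply: bE; rewrite natrM; field.
rewrite !exprMn exprVn sqr_sqrtr ?(ltW e0)// exprVn sqr_sqrtr ?(ltW n0)//.
have dE : \sum_(2 <= j < J.+1) 744 * b ^+ (4 * J + 16 * j) / (eta * n%:R) <=
    5952 * b ^+ (20 * J) * (eta^-1 / n%:R).
  rewrite (eq_bigr (fun j => 744 * (b ^+ (4 * J) * (eta^-1 / n%:R) * b ^+ (16 * j)))); last first.
    move=> j _; rewrite invfM exprD.
    by move: (b ^+ _) (b ^+ _) (eta^-1) (n%:R^-1) => x y z w; ring.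
  rewrite -!mulr_sumr.
  have := ler_wpM2l (mulr_ge0 (bb (4 * J)%N) eE0) (sum_root40_le J br).
  have -> : b ^+ (20 * J) = b ^+ (4 * J) * b ^+ (16 * J) by rewrite -exprD -mulnDl.
  move: (b ^+ _) (b ^+ _) (eta^-1 / _) (\sum_(_ <= _ < _) _) => x y z w; clear=> h.
  have -> : 5952 * (y * x) * z = 744 * (y * z * (8 * x)) by ring.
  by rewrite (ler_wpM2l (ler0n _ _) h).
rewrite big_split /= -[in X in _ + X]mulr_sumr sumr_const_nat -[_ *+ _]mulr_natr.
have Jb : (J.+1 - 2)%:R <= 8 * b ^+ (8 * J).
  by apply: le_trans (nat_le_root40 J br); rewrite ler_nat leq_subLR addSn add1n leqW.
have b16 : b ^+ (8 * J) * b ^+ (8 * J) <= b ^+ (20 * J).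
  by rewrite -exprD -mulnDl ler_weXn2l// leq_mul2r orbT.
have -> : (b ^+ (4 * J)) ^+ 2 = b ^+ (8 * J) by rewrite -exprM mulnAC.
have K1 := ler_wpM2l (mulr_ge0 (bb (8 * J)%N) eE0) Jb; have K2 := ler_wpM2r eE0 b16.
have K3 := mulr_ge0 (bb (20 * J)%N) eE0.
move: dE K1 K2 K3; move: (b ^+ (20 * J)) (b ^+ (8 * J)) (\sum_(_ <= _ < _) _) ((_ - _)%:R).
move: (eta^-1) (n%:R^-1) => x y; clear=> z w S N; rewrite !expr2; lra.
Qed.

(** The hypothesis is what acceptance of all statistics implies off the bad
    event. *)
Lemma undetected_near_ball (R : realType) (psi : nat -> nat -> R -> R)
    (f : R -> R) (s t L eta : R) (n : nat) :
  orthonormal_basis psi -> 0 < t -> t < s -> 0 < L -> 0 < eta < 1 -> (1 <= n)%N ->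
  besov_ball psi t L f ->
  (forall m, (2 <= m <= Jmax t n)%N ->
     \sum_(2 <= j < m.+1) 4 `^ (j%:R * s) * level_energy psi f j <=
     L ^+ 2 + 4 / Num.sqrt (alpha_ t eta n m) *
       (Num.sqrt (m%:R - 1) / Num.sqrt n%:R *
         (\big[Num.max/0]_(2 <= j < m.+1)
            (4 `^ (j%:R * s) * Num.sqrt (level_energy psi f j)) + D_ s eta n m) +
        4 `^ (m%:R * s) * (2 `^ (m%:R / 2) / n%:R))) ->
  exists2 h, besov_ball psi s L h &
    L2norm (fun x => f x - h x) <= rate_const t L eta * rate t n.
Proof.
move=> onb t0 ts L0 e01 n1 fB H; have /andP[e0 e1] := e01.
have s0 : 0 < s by exact: lt_trans ts.
have [b br] := root40_exists R.
pose u j := Num.sqrt (level_energy psi f j).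
pose W (j : nat) : R := 4 `^ (j%:R * s).
have u2 j : u j ^+ 2 = level_energy psi f j by rewrite sqr_sqrtr// level_energy_ge0.
have u0 j : 0 <= u j by exact: sqrtr_ge0.
have W0 j : 0 < W j by rewrite powR_gt0.
have [b1 _ _] := br; have b0 : 0 <= b by exact: le_trans b1.
have c0 := budget_c_ge0 t eta n b0.
have d0 m := budget_delta_ge0 t n m b0 (ltW e0).
have Wle i j : (i <= j)%N -> W i <= W j.
  by move=> ij; rewrite /W ler_powR ?ler1n// ler_wpM2r ?(ltW s0)// ler_nat.
have [|v [vu vL uv]] := @soft_threshold_then_truncate _ u W (budget_delta b t eta n)
    (L ^+ 2) (budget_c b t eta n) (Jmax t n).+1 u0 W0 Wle (sqr_ge0 L) c0 d0.
  move=> m; rewrite ltnS => mJ; have /andP[m2 mJ'] := mJ.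
  have [|l] := @bigmax_seq_attained _ _ (fun j => W j * u j) (index_iota 2 m.+1)
    (fun j => mulr_ge0 (ltW (W0 j)) (u0 j)).
    by rewrite -size_eq0 size_iota subn_eq0 -ltnNge ltnS.
  rewrite mem_index_iota ltnS => lm eM; exists l => //.
  under eq_bigr do rewrite u2.
  apply: le_trans (H m mJ) _; rewrite eM -addrA lerD2l.
  have K1 := budget_delta_ge s br e01 n1 mJ'.
  have K2 := ler_wpM2r (mulr_ge0 (ltW (W0 l)) (u0 l)) (budget_c_ge br e0 mJ').
  apply: le_trans (lerD K2 K1).
  move: (4 / _) (_ / Num.sqrt n%:R) (D_ _ _ _ _) (W l * u l) (_ * (_ / n%:R)); clear=> x y z w v.
  by rewrite le_eqVlt; apply/orP; left; apply/eqP; ring.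
have [h hB hd] := besov_distance_le onb t0 (ltW L0) fB vu vL.
exists h => //.
have k0 := ltW (rate_const_gt0 t0 L0 e0); have r0 := ltW (rate_gt0 t n1).
rewrite -(ler_pXn2r (n := 2)) ?nnegrE ?sqrtr_ge0 ?(mulr_ge0 k0 r0)//.
apply: le_trans hd _.
have T1 : \sum_(2 <= j < (Jmax t n).+1) (u j - v j) ^+ 2 <=
    (1346 / Num.sqrt eta) ^+ 2 * rate t n ^+ 2.
  by apply: le_trans (budget_total br t0 e0 n1); apply: ler_sum_nat => j; exact: uv.
have T2 : L ^+ 2 / 4 `^ ((Jmax t n).+1%:R * t) <= L ^+ 2 * rate t n ^+ 2.
  by have := four_powR_Jmax_ge t0 n1; rewrite div1r => /(ler_wpM2l (sqr_ge0 L)).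
apply: le_trans (lerD T1 T2) _; rewrite -mulrDl [leRHS]exprMn.
apply: ler_wpM2r; first exact: sqr_ge0.
rewrite /rate_const.
have : L <= L / (1 - 2 `^ (- t)).
  have x0 : 0 < (2 : R) `^ (- t) by rewrite powR_gt0.
  have x1 := two_powRN_lt1 t0.
  rewrite ler_pdivlMr ?subr_gt0// mulrBr mulr1 lerBlDr lerDl.
  by rewrite mulr_ge0// ltW.
have : 0 <= 1346 / Num.sqrt eta by apply: divr_ge0; [exact: ler0n|exact: sqrtr_ge0].
move: (1346 / _) (L / _) => x y; move: L0; clear=> L0 x0 Ly.
rewrite [leRHS]sqrrD -addrA lerD2l -[leLHS]add0r lerD//.
  by rewrite mulrn_wge0// mulr_ge0// (le_trans (ltW L0)).
by rewrite lerXn2r// nnegrE ?(ltW L0)// (le_trans (ltW L0)).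
Qed.

Theorem theorem3p1 (R : realType) (psi : nat -> nat -> R -> R)
    (s t L eta : R)
    (hpsi : orthonormal_basis psi)
    (ht : 0 < t) (hst : t < s) (hL : 0 < L) (heta : 0 < eta < 1) :
  (forall n : nat, (1 <= n)%N ->
   forall (d : measure_display) (T : measurableType d)
     (P : (R -> R) -> probability T R) (ahat : nat -> nat -> {mfun T >-> R}),
     white_noise_model psi n P ahat ->
     let phi := fun w : T => the_test s t L eta n (fun j k => ahat j k w) in
     [/\ is_test ahat phi,
         forall rho : R, rate_const t L eta * rate t n <= rho ->
           (risk psi s t L P phi rho <= eta%:E)%E
       & (separation_distance psi s t L P ahat eta <=
            (rate_const t L eta * rate t n)%:E)%E]) /\
  (exists C : R, 0 < C /\
   forall n : nat, (1 <= n)%N ->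
   forall (d : measure_display) (T : measurableType d)
     (P : (R -> R) -> probability T R) (ahat : nat -> nat -> {mfun T >-> R}),
     white_noise_model psi n P ahat ->
     (separation_distance psi s t L P ahat eta <= (C * rate t n)%:E)%E).
Proof.
have /andP[e0 e1] := heta; have s0 : 0 < s by exact: lt_trans hst.
have rc0 := rate_const_gt0 ht hL e0.
suff main : forall n : nat, (1 <= n)%N ->
   forall (d : measure_display) (T : measurableType d)
     (P : (R -> R) -> probability T R) (ahat : nat -> nat -> {mfun T >-> R}),
     white_noise_model psi n P ahat ->
     let phi := fun w : T => the_test s t L eta n (fun j k => ahat j k w) in
     [/\ is_test ahat phi,
         forall rho : R, rate_const t L eta * rate t n <= rho ->
           (risk psi s t L P phi rho <= eta%:E)%E
       & (separation_distance psi s t L P ahat eta <=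
            (rate_const t L eta * rate t n)%:E)%E].
  split => //; exists (rate_const t L eta); split => // n n1 d T P ahat wn.
  by have [] := main n n1 d T P ahat wn.
move=> n n1 d T P ahat wn phi.
have test : is_test ahat phi by exact: the_test_is_test.
have risk_le rho : rate_const t L eta * rate t n <= rho ->
    (risk psi s t L P phi rho <= eta%:E)%E.
  move=> hrho; rewrite /risk.
  have -> : (eta%:E = (eta / 2)%:E + (eta / 2)%:E)%E.
    by rewrite -EFinD; congr (_%:E); field.
  have h0 : (0 <= (eta / 2)%:E)%E by rewrite lee_fin divr_ge0// ltW.
  have mphi : measurable [set w | phi w = true].
    by apply: measurable_the_test.
  apply: leeD.
  - apply: ge_ereal_sup => _ [->|[f fB <-]]; first exact: h0.
    have [fL fs] := (besov_ballP psi s f (ltW hL)).1 fB.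
    have [E [mE PE nE]] := bad_event t n1 wn fL (ltW s0) e0.
    apply: le_trans PE; apply: le_measure; rewrite ?inE//.
    move=> w /the_testP[m mJ]; apply: contraPP => Ew; apply/negP; rewrite -leNgt.
    have /andP[_ ub] := nE w Ew m mJ; apply: le_trans ub _.
    rewrite /tau_ lerD ?fs// le_eqVlt; apply/orP; left; apply/eqP.
    by rewrite addrC.
  - apply: ge_ereal_sup => _ [->|[f [fB far] <-]]; first exact: h0.
    have [fL ft] := (besov_ballP psi t f (ltW hL)).1 fB.
    have [E [mE PE nE]] := bad_event t n1 wn fL (ltW s0) e0.
    apply: le_trans PE; apply: le_measure; rewrite ?inE//.
      rewrite (_ : [set w | _] = ~` [set w | phi w = true]); first exact: measurableC.
      by apply/seteqP; split=> w /=; case: (phi w).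
    move=> w /= phiw; apply: contrapT => Ew.
    have [|h hB hd] := undetected_near_ball (f := f) hpsi ht hst hL heta n1 fB.
      move=> m mJ.
      have : T_ s t eta n m (fun j k => ahat j k w) <= tau_ s t L eta n m.
        rewrite leNgt; apply/negP => lt.
        suff : phi w by rewrite phiw.
        by apply/the_testP; exists m.
      have /andP[lb _] := nE w Ew m mJ; move=> /(le_trans lb).
      rewrite /tau_ lerBlDr => /le_trans; apply; rewrite -addrA lerD2l.
      move: (alpha_ _ _ _ _) (_ / Num.sqrt n%:R) (D_ _ _ _ _) (\big[_/_]_(_ <= _ < _) _) (_ * (_ / n%:R)).
      clear=> x y z w v; rewrite le_eqVlt; apply/orP; left; apply/eqP; ring.
    have : (ereal_inf [set (L2norm (fun x => f x - h x))%:E | h in besov_ball psi s L] <= rho%:E)%E.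
      apply: (@le_trans _ _ (L2norm (fun x => f x - h x))%:E).
        by apply: ereal_inf_lbound; exists h.
      by rewrite lee_fin; exact: le_trans hrho.
    by rewrite leNgt far.
split => //.
apply: ereal_inf_lbound; exists (rate_const t L eta * rate t n) => //.
split; first by rewrite mulr_gt0// rate_gt0.
by exists phi; split => //; exact: risk_le.
Qed.
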